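(* Let $\mu\vdash k$ and let $\sigma\in S(k)$ be a permutation of type $\mu$. Define $$\Sigma'_\mu=\sum_{\substack{\tau,\overline{\tau}\in S(k)\\ \tau\overline{\tau}=\sigma\\ \langle\tau,\overline{\tau}\rangle\ \mathrm{transitive}}}(-1)^{|C(\tau)|+1}N^{\tau,\overline{\tau}},$$ where the last condition means that the subgroup of $S(k)$ generated by $\tau$ and $\overline{\tau}$ acts transitively on $\{1,\dots,k\}$. Then there exists a polynomial $K'_\mu$ with non-negative integer coefficients such that, as power series in $\mathbf{p},\mathbf{q}$, $$\Sigma'_\mu=K'_\mu(R_2,\dots,R_{k+1}).$$
   Context: $\mathbf{p}=(p_1,p_2,\dots)$ and $\mathbf{q}=(q_1,q_2,\dots)$ are two infinite families of indeterminates, and $\mathbb{N}^\star=\{1,2,\dots\}$. For a permutation $\tau\in S(k)$, $C(\tau)$ denotes the set of orbits of $\tau$ on $\{1,\dots,k\}$ (fixed points included). The type of $\sigma$ is the partition of $k$ given by its cycle lengths. For $\tau,\overline{\tau}\in S(k)$, the power series $N^{\tau,\overline{\tau}}\in\mathbb{C}[[\mathbf{p},\mathbf{q}]]$ is $$N^{\tau,\overline{\tau}}=\sum_{\psi}\ \prod_{w\in C(\tau)}p_{\psi(w)}\prod_{b\in C(\overline{\tau})}q_{\psi(b)},$$ the sum running over all functions $\psi:C(\tau)\sqcup C(\overline{\tau})\to\mathbb{N}^\star$ such that $\psi(b)\ge\psi(w)$ whenever $w\in C(\tau)$ and $b\in C(\overline{\tau})$ satisfy $w\cap b\ne\emptyset$.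 For $l\ge1$, the free cumulant $R_{l+1}$, viewed as a power series in $\mathbf{p},\mathbf{q}$, is $$R_{l+1}=\sum_{\substack{\tau,\overline{\tau}\in S(l)\\ \tau\overline{\tau}=(1\,2\,\ldots\,l)\\ |C(\tau)|+|C(\overline{\tau})|=l+1}}(-1)^{|C(\tau)|+1}N^{\tau,\overline{\tau}}.$$ (For sequences of non-negative integers $\mathbf{p},\mathbf{q}$ with finitely many non-zero terms, its value is the $(l+1)$-th free cumulant of the transition measure of the Young diagram having, for each $i\geq 1$, $p_i$ rows of length $\sum_{j\ge i}q_j$.) *)

(* Defs.v *)
From HB Require Import structures.
From mathcomp Require Import all_boot all_order all_algebra all_fingroup.
From mathcomp Require Import finmap monalg mpoly.
From mathcomp Require Import mathcomp_extra boolp classical_sets functions.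
From mathcomp Require Import cardinality fsbigop reals complex.

Set Implicit Arguments.
Unset Strict Implicit.
Unset Printing Implicit Defensive.

Import GRing.Theory.

Local Open Scope classical_set_scope.
Local Open Scope ring_scope.

(** The ring C[[x_i, i in I]] for an arbitrary, possibly infinite, set [I] of
    commuting indeterminates: coefficients are indexed by the monomials over
    [I], i.e. by the finitely supported exponent functions [{cmonom I}], and no
    condition is imposed on the family of coefficients. *)

Record mvseries (C : Type) (I : choiceType) :=
  MvSeries { mvcoef : {cmonom I} -> C }.

Lemma finite_set_injfin (T : Type) (F : finType) (A : set T) (h : T -> F) :
  {in A &, injective h} -> finite_set A.
Proof.
by move=> /inj_card_eq hA; rewrite -(eq_finite_set hA); apply: finite_finset.
Qed.

Section Factorizations.
Variable I : choiceType.
Implicit Types m a b : {cmonom I}.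

Definition mfactor m : set ({cmonom I} * {cmonom I}) :=
  [set ab | mmul ab.1 ab.2 = m].

Lemma cmulI a : injective (mmul a).
Proof.
move=> b c /(congr1 (fun m : {cmonom I} => m : I -> nat)) E.
by apply/eqP/cmP => i; have := congr1 (@^~ i) E; rewrite /= !cmM => /addnI.
Qed.

Lemma finite_mdivisor m : finite_set [set a | exists b, mmul a b = m].
Proof.
pose J := finsupp m; pose K := (\sum_(i <- J) m i)%N.
have leK i : i \in J -> (m i < K.+1)%N.
  by move=> iJ; rewrite ltnS /K (big_fsetD1 i) ?leq_addr.
pose h a : {ffun J -> 'I_K.+1} := [ffun i : J => inord (a (val i))].
apply: (@finite_set_injfin _ _ _ h) => a a'.
rewrite !inE /= => -[b abm] [b' abm'] E; apply/eqP/cmP => i.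
have [iJ|] := boolP (i \in J); last first.
  rewrite -cmE_eq0 => /eqP mi.
  have := congr1 (fun m : {cmonom I} => m i) abm.
  have := congr1 (fun m : {cmonom I} => m i) abm'.
  by rewrite !cmM mi => /eqP + /eqP; rewrite !addn_eq0 => /andP[/eqP-> _] /andP[/eqP-> _].
have := congr1 (fun g : {ffun J -> 'I_K.+1} => nat_of_ord (g [` iJ]%fset)) E.
have lt c d : mmul c d = m -> (c i < K.+1)%N.
  by move=> cd; apply: leq_ltn_trans (leK i iJ); rewrite -cd cmM leq_addr.
by rewrite /h !ffunE /= !inordK ?(lt _ _ abm) ?(lt _ _ abm').
Qed.

Lemma finite_mfactor m : finite_set (mfactor m).
Proof.
apply: (@sub_finite_set _ _ ([set a | exists b, mmul a b = m] `*`
  [set a | exists b, mmul a b = m])); last by apply: finite_setX; apply: finite_mdivisor.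
by move=> -[a b] /= abm; split; [exists b | exists a; rewrite monalg.mulmC].
Qed.

Definition mdivs m : {fset {cmonom I}} :=
  fset_set [set a | exists b, mmul a b = m].

Lemma mdivsP m a : reflect (exists b, mmul a b = m) (a \in mdivs m).
Proof.
rewrite /mdivs in_fset_set; last exact: finite_mdivisor.
by apply: (iffP idP) => [/set_mem|/mem_set].
Qed.

Lemma sum_mfactor (C : nmodType) m n (F : {cmonom I} -> {cmonom I} -> C) :
  n \in mdivs m ->
  \sum_(ab \in mfactor n) F ab.1 ab.2 =
  \sum_(a <- mdivs m) \sum_(b <- mdivs m) F a b *+ (mmul a b == n).
Proof.
move=> /mdivsP[r nrm].
have sub a b : mmul a b = n -> (a \in mdivs m) && (b \in mdivs m).
  move=> abn; apply/andP; split; apply/mdivsP.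
    by exists (mmul b r); rewrite monalg.mulmA abn.
  by exists (mmul a r); rewrite monalg.mulmA (monalg.mulmC b) abn.
rewrite (@fsbigE _ _ _ _ _ (filter (fun ab => mmul ab.1 ab.2 == n)
   [seq (a, b) | a <- mdivs m, b <- mdivs m])) /=.
- rewrite big_filter_cond big_mkcond /= big_allpairs /=.
  apply: eq_bigr => a _; apply: eq_bigr => b _.
  by case: eqP => [abn|]; rewrite ?mulr0n // mulr1n mem_set.
- by rewrite filter_uniq // allpairs_uniq ?fset_uniq // => -[? ?] [? ?].
- by move=> -[a b] /=; rewrite mem_filter => /andP[/eqP].
- move=> -[a b] /= abn; rewrite mem_filter abn eqxx /= => /negP[].
  by apply/allpairsP; exists (a, b); case/andP: (sub _ _ abn).
Qed.

End Factorizations.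

Section SeriesRing.
Variables (C : comNzRingType) (I : choiceType).
Local Notation S := (mvseries C I).
Implicit Types (f g h : S) (m : {cmonom I}).

HB.instance Definition _ := gen_eqMixin S.
HB.instance Definition _ := gen_choiceMixin S.

Lemma mvseriesP f g : (forall m, mvcoef f m = mvcoef g m) -> f = g.
Proof. by case: f g => [f] [g] /= /funext ->. Qed.

Definition mvzero : S := MvSeries (fun=> 0).
Definition mvopp f : S := MvSeries (fun m => - mvcoef f m).
Definition mvadd f g : S := MvSeries (fun m => mvcoef f m + mvcoef g m).
Definition mvone : S := MvSeries (fun m => (m == mone)%:R).

Definition mvmul f g : S :=
  MvSeries (fun m => \sum_(ab \in mfactor m) mvcoef f ab.1 * mvcoef g ab.2).

Lemma mvaddA : associative mvadd.
Proof. by move=> f g h; apply: mvseriesP => m /=; rewrite addrA. Qed.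
Lemma mvaddC : commutative mvadd.
Proof. by move=> f g; apply: mvseriesP => m /=; rewrite addrC. Qed.
Lemma mvadd0 : left_id mvzero mvadd.
Proof. by move=> f; apply: mvseriesP => m /=; rewrite add0r. Qed.
Lemma mvaddN : left_inverse mvzero mvopp mvadd.
Proof. by move=> f; apply: mvseriesP => m /=; rewrite addNr. Qed.

HB.instance Definition _ :=
  GRing.isZmodule.Build S mvaddA mvaddC mvadd0 mvaddN.

Lemma mdivs_refl m : m \in mdivs m.
Proof. by apply/mdivsP; exists mone; rewrite mulm1. Qed.

Lemma coef_mvmul f g m n : n \in mdivs m ->
  mvcoef (mvmul f g) n =
  \sum_(a <- mdivs m) \sum_(b <- mdivs m)
     (mvcoef f a * mvcoef g b) *+ (mmul a b == n).
Proof.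
exact: (@sum_mfactor _ C m n (fun a b => mvcoef f a * mvcoef g b)).
Qed.

Lemma mvmulC : commutative mvmul.
Proof.
move=> f g; apply: mvseriesP => m; rewrite !(coef_mvmul _ _ (mdivs_refl m)).
rewrite exchange_big; apply: eq_bigr => a _; apply: eq_bigr => b _.
by rewrite mulrC monalg.mulmC.
Qed.

Lemma mvmulA : associative mvmul.
Proof.
move=> f g h; apply: mvseriesP => m; rewrite !(coef_mvmul _ _ (mdivs_refl m)).
pose T a b c := (mvcoef f a * mvcoef g b * mvcoef h c)
   *+ (mmul (mmul a b) c == m).
have pick (n : {cmonom I}) (F : {cmonom I} -> bool) (x : C) :
    (F n -> n \in mdivs m) ->
    \sum_(y <- mdivs m) x *+ F y *+ (n == y) = x *+ F n.
  move=> Fn; have [FT|/negbTE nF] := boolP (F n).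
    rewrite (bigD1_seq n) ?Fn ?fset_uniq //= eqxx mulr1n.
    rewrite big1 ?addr0 ?FT // => y /negbTE; rewrite eq_sym => ->.
    by rewrite mulr0n.
  rewrite big1 // => y _; case: eqP => [<-|]; rewrite ?mulr0n //.
  by rewrite nF.
transitivity (\sum_(a <- mdivs m) \sum_(b <- mdivs m) \sum_(c <- mdivs m) T a b c).
  apply: eq_bigr => a _.
  under eq_big_seq => x xm.
    rewrite (coef_mvmul _ _ xm) mulr_sumr -sumrMnl.
    under eq_bigr => b _ do rewrite mulr_sumr -sumrMnl.
    over.
  rewrite exchange_big; apply: eq_bigr => b _.
  rewrite exchange_big; apply: eq_bigr => c _.
  rewrite /T -monalg.mulmA -(pick (mmul b c) (fun x => mmul a x == m)).
    by apply: eq_bigr => x _; rewrite mulrnAr mulrA -!mulrnA mulnC.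
  by move=> /eqP abc; apply/mdivsP; exists a; rewrite monalg.mulmC.
apply/esym; rewrite exchange_big.
transitivity (\sum_(c <- mdivs m) \sum_(a <- mdivs m) \sum_(b <- mdivs m) T a b c).
  apply: eq_bigr => c _.
  under eq_big_seq => x xm.
    rewrite (coef_mvmul _ _ xm) mulr_suml -sumrMnl.
    under eq_bigr => b _ do rewrite mulr_suml -sumrMnl.
    over.
  rewrite exchange_big; apply: eq_bigr => a _.
  rewrite exchange_big; apply: eq_bigr => b _.
  rewrite /T -(pick (mmul a b) (fun x => mmul x c == m)).
    by apply: eq_bigr => x _; rewrite mulrnAl -!mulrnA mulnC.
  by move=> /eqP abc; apply/mdivsP; exists c.
rewrite exchange_big; apply: eq_bigr => a _.
by rewrite exchange_big.
Qed.

Lemma mvmul1 : left_id mvone mvmul.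
Proof.
move=> f; apply: mvseriesP => m; rewrite (coef_mvmul _ _ (mdivs_refl m)).
have one_m : mone \in mdivs m by apply/mdivsP; exists m; rewrite mul1m.
rewrite (bigD1_seq mone) ?fset_uniq //= [X in _ + X]big1 ?addr0.
  rewrite (bigD1_seq m) ?fset_uniq ?mdivs_refl //= [X in _ + X]big1 ?addr0.
    by rewrite !mul1m !eqxx mul1r.
  by move=> b /negbTE bm; rewrite mul1m bm.
by move=> a /negbTE a1; apply: big1 => b _; rewrite a1 mul0r mul0rn.
Qed.

Lemma mvmulDl : left_distributive mvmul mvadd.
Proof.
move=> f g h; apply: mvseriesP => m /=.
rewrite -fsbig_split; last exact: finite_mfactor.
by apply: eq_fsbigr => ab _; rewrite mulrDl.
Qed.

Lemma mvone_neq0 : mvone != 0.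
Proof.
apply/eqP => /(congr1 (fun f => mvcoef f mone)) /=; rewrite eqxx.
by apply/eqP; rewrite oner_neq0.
Qed.

HB.instance Definition _ := GRing.Zmodule_isComNzRing.Build S
  mvmulA mvmulC mvmul1 mvmulDl mvone_neq0.

Definition mvX (i : I) : S := MvSeries (fun m => (m == ucm i)%:R).

(** The sum of a family of power series is taken coefficientwise. It is
    meaningful for the families in which each monomial occurs finitely often;
    a monomial occurring infinitely often gets coefficient 0. *)
Definition mvsummable (J : choiceType) (A : set J) (F : J -> S) : Prop :=
  forall m, finite_set (A `&` [set j | mvcoef (F j) m != 0]).

Definition mvsum (J : choiceType) (A : set J) (F : J -> S) : S :=
  MvSeries (fun m => \sum_(j \in A) mvcoef (F j) m).

Lemma coef_mvX_mul i f m : mvcoef (mvX i * f) m != 0 -> m i != 0%N.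
Proof.
rewrite (coef_mvmul _ _ (mdivs_refl m)) => /eqP nz; apply/eqP => mi0.
apply: nz; rewrite big1 // => a _; rewrite big1 // => b _ /=.
case: eqP => [ai|]; last by rewrite mul0r mul0rn.
case: eqP => [abm|]; last by rewrite mulr0n.
by move: mi0; rewrite -abm ai cmM cmUU.
Qed.

Lemma coef_prod_mvX (J : finType) (v : J -> I) m :
  mvcoef (\prod_j mvX (v j)) m != 0 -> forall j, m (v j) != 0%N.
Proof. by move=> nz j; move: nz; rewrite (bigD1 j) //=; apply: coef_mvX_mul. Qed.

Lemma prod_mvX_summable (J : finType) (K : choiceType) (A : set K)
    (v : K -> J -> I) :
  (forall x y, v x =1 v y -> x = y) ->
  mvsummable A (fun x => \prod_j mvX (v x j)).
Proof.
move=> vinj m.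
pose h (x : K) : {ffun J -> option (finsupp m)} := [ffun j => insub (v x j)].
apply: (@finite_set_injfin _ _ _ h) => x y /set_mem + /set_mem.
move=> -[_ /coef_prod_mvX nzx] [_ /coef_prod_mvX nzy] E; apply: vinj => j.
have := congr1 (fun u : {ffun J -> option (finsupp m)} => u j) E.
have xm : v x j \in finsupp m by rewrite -cmE_neq0.
have ym : v y j \in finsupp m by rewrite -cmE_neq0.
by rewrite !ffunE !insubT => -[].
Qed.

End SeriesRing.

Definition Nstar := {n : nat | (0 < n)%N}.

(** [inl i] indexes the indeterminate p_i and [inr i] the indeterminate q_i. *)
Definition pqseries (C : comNzRingType) := mvseries C (Nstar + Nstar)%type.

HB.instance Definition _ (C : comNzRingType) :=
  GRing.ComNzRing.copy (pqseries C) (mvseries C (Nstar + Nstar)%type).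

Definition pvar {C : comNzRingType} (i : Nstar) : pqseries C := mvX C (inl i).
Definition qvar {C : comNzRingType} (i : Nstar) : pqseries C := mvX C (inr i).

Definition perm_orbit (k : nat) (s : 'S_k) := {w : {set 'I_k} | w \in porbits s}.

Section Kerov.
Variable C : comNzRingType.

Section Nseries.
Variables (k : nat) (tau taub : 'S_k).

Definition coloring := {ffun perm_orbit tau + perm_orbit taub -> Nstar}.

Definition admissible (psi : coloring) : Prop :=
  forall (w : perm_orbit tau) (b : perm_orbit taub),
    val w :&: val b != finset.set0 ->
    (val (psi (inl w)) <= val (psi (inr b)))%N.

Definition colterm (psi : coloring) : pqseries C :=
  (\prod_(w : perm_orbit tau) pvar (psi (inl w))) *
  (\prod_(b : perm_orbit taub) qvar (psi (inr b))).

Definition Nseries : pqseries C := mvsum [set psi | admissible psi] colterm.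

Lemma Nseries_summable : mvsummable [set psi | admissible psi] colterm.
Proof.
pose v (psi : coloring) (x : perm_orbit tau + perm_orbit taub) :
    (Nstar + Nstar)%type :=
  match x with inl _ => inl (psi x) | inr _ => inr (psi x) end.
have -> : colterm = fun psi => \prod_x mvX C (v psi x).
  by apply: funext => psi; rewrite big_sumType.
apply: prod_mvX_summable => psi phi E; apply/ffunP => x.
by move: (E x); rewrite /v; case: x => x [].
Qed.

End Nseries.

Definition long_cycle (l : nat) : 'S_l := perm (@ordS_inj l).

(** [free_cumulant n] is R_n, meaningful for [n >= 2]. As [(s * t)%g] maps [x]
    to [t (s x)], the product tau taub of the mathematical literature, which
    applies taub first, is [(taub * tau)%g]. *)
Definition free_cumulant (n : nat) : pqseries C :=
  let l := n.-1 in
  \sum_(tau : 'S_l) \sum_(taub : 'S_l |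
      ((taub * tau)%g == long_cycle l) &&
      (#|porbits tau| + #|porbits taub| == l.+1)%N)
    (-1) ^+ #|porbits tau|.+1 * Nseries tau taub.

Definition Sigma' (k : nat) (sigma : 'S_k) : pqseries C :=
  \sum_(tau : 'S_k) \sum_(taub : 'S_k |
      ((taub * tau)%g == sigma) &&
      [transitive <<[set tau; taub]%SET>>%g, on [set: 'I_k]%SET | 'P])
    (-1) ^+ #|porbits tau|.+1 * Nseries tau taub.

End Kerov.

Definition is_partition (k : nat) (mu : seq nat) : bool :=
  [&& sorted geq mu, 0%N \notin mu & sumn mu == k].

Definition cycle_type (k : nat) (s : 'S_k) : seq nat :=
  sort geq [seq #|pred_of_set w| | w <- enum (porbits s)].

(* Main.v *)
(** A factorization [sigma = tau taub] is a bipartite map with labelled edges, and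
    N counts the points of the cone of the inequalities psi(w) <= psi(b), one for
    each edge. Dually, the edges span a cone (the root polytope of the bipartite
    graph), and a triangulation of it expands the indicator function of the cone
    of inequalities as an alternating sum, over the interior faces, of the ones
    of spanning forests. The triangulation used here comes from walking along the
    boundary of a spanning tree: its maximal simplices are the trees T such that
    each edge outside T is first met at its black end, and a forest F = T - V
    occurs with sign (-1)^|V| when each e in V is met at its black end first and
    some edge outside T interlaces with e in the tour.

    The tour, hence this condition, does not change, up to conjugation, when
    (tau, taub) is replaced by (tau r, r^-1 taub) with r a permutation of F. In
    such a class, factorizations in which the components of F are trees are
    obtained by choosing, for each component with l edges, a noncrossing
    factorization of a cycle of length l. Summing over a class thus gives, with
    the right sign, a product of free cumulants; the classes enumerate the
    monomials of the Kerov polynomial. *)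
Require Import Defs.
From mathcomp Require Import all_boot all_order all_algebra all_fingroup.
From mathcomp Require Import zify.

Set Implicit Arguments.
Unset Strict Implicit.
Unset Printing Implicit Defensive.
Import GRing.Theory.

(** * Cycles of permutations *)

(** Branching at a half-edge requires an edge to have one weight for all trees of a branch, although
    flippability is read off the complete tour. It does: an edge is flippable exactly when it is
    first met at its black end and the map stays connected without it and the edges deleted so far.
    Interlacing enters a second time to ensure that removing [V] isolates no vertex; hence the
    colourings summed over are the same for [T :\: V] as for the whole map, and vertices can be
    counted on [T :\: V] alone. Positivity is a count of signs: for a marked tree, the permutation
    multiplied out on [T :\: V] has [#|V|.+1] cycles, so the sign of [V] together with the extra
    sign in the sum supplies one sign for each free cumulant. Infinitely many indeterminates are
    avoided by fixing a monomial: finitely many colours suffice for all its divisors, and the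
    identities are proved for finite colour sets with arbitrary values in a ring. *)

Section PermCycles.
Local Open Scope group_scope.
Variable T : finType.
Implicit Types (p s a b : {perm T}) (x y z : T) (X : {set T}).

(* [mulgA] restated so that [lia] recognizes the products in its result. *)
Lemma mulpA a b c : a * (b * c) = a * b * c. Proof. exact: mulgA. Qed.

Lemma porbit_fconnect s x y : (y \in porbit s x) = fconnect s x y.
Proof.
apply/porbitP/idP => [[i ->]|/iter_findex <-].
  by rewrite permX fconnect_iter.
by exists (findex s x y); rewrite permX.
Qed.

Lemma porbit_step s x y : (s y \in porbit s x) = (y \in porbit s x).
Proof.
have := porbit_perm s 1 y; rewrite expg1 => E.
by rewrite !(porbit_sym s _ x) -!eq_porbit_mem E.
Qed.

Lemma sub_porbit s X x :
  (forall y, y \in X -> s y \in X) -> x \in X -> porbit s x \subset X.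
Proof.
move=> sX xX; apply/subsetP => y /porbitP[i ->]; rewrite permX.
by elim: i => //= i; apply: sX.
Qed.

Lemma porbit_stable s X x y :
  (forall y, y \in X -> s y \in X) -> y \in porbit s x -> (x \in X) = (y \in X).
Proof.
move=> sX xy; apply/idP/idP => [xX|yX]; first exact: (subsetP (sub_porbit sX xX)).
by apply: (subsetP (sub_porbit sX yX)); rewrite porbit_sym.
Qed.

Lemma porbits_tperm_split s x y : x != y -> x \in porbit s y ->
  #|porbits (tperm x y * s)| = #|porbits s|.+1.
Proof. by move=> xy xs; have := porbits_mul_tperm s x y; rewrite xy xs /= addn0 addn1. Qed.

Lemma leq_tperm_porbits s x y : #|porbits (tperm x y * s)| <= #|porbits s|.+1.
Proof.
have := porbits_mul_tperm s x y; rewrite /=.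
case: eqP => [->|_]; first by rewrite porbit_id /=; lia.
by case: (_ \notin _); lia.
Qed.

Lemma leq_porbits_tperm s x y : #|porbits s| <= #|porbits (tperm x y * s)|.+1.
Proof.
by have := leq_tperm_porbits (tperm x y * s) x y; rewrite mulgA tperm2 mul1g.
Qed.

Lemma porbits1 : #|porbits (1 : {perm T})| = #|T|.
Proof.
rewrite /porbits card_imset ?cardsT // => x y xy.
by have := porbit_id 1 x; rewrite xy => /porbitP[i ->]; rewrite expg1n perm1.
Qed.

(* Transposition length is subadditive: peel off the transposition
   [(x a(x))] from [a] until [a] is trivial. *)
Lemma porbits_mul_ge a b : #|porbits a| + #|porbits b| <= #|T| + #|porbits (a * b)|.
Proof.
have [n] := ubnP (#|T| - #|porbits a|); elim: n a => // n IHn a.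
have [->|/eqP/permP] := eqVneq a 1; first by rewrite mul1g porbits1.
move=> a1 leT; have [x ax] : exists x, a x != x.
  apply/existsP; apply: contra_notT a1; rewrite negb_exists => /forallP h x.
  by apply/eqP; move: (h x); rewrite perm1 negbK.
have xa : a x \in porbit a x by rewrite porbit_step porbit_id.
have E := porbits_tperm_split ax xa.
have lta : #|porbits (tperm (a x) x * a)| <= #|T|.
  by apply: leq_trans (leq_imset_card _ _) _; rewrite max_card.
have := leq_tperm_porbits (a * b) (a x) x; rewrite mulpA.
rewrite E in lta; have lt : #|T| - #|porbits (tperm (a x) x * a)| < n by lia.
by have := IHn _ lt; rewrite E; lia.
Qed.

(** Peeling [tperm (a x) x] off [a] gains a cycle, so [porbits_mul_ge] for the shorter factor forces
    the same transposition to split a cycle of [a * b]. *)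
Lemma porbits_mul_geodesic a b x :
  #|porbits a| + #|porbits b| = #|T| + #|porbits (a * b)| ->
  a x \in porbit (a * b) x.
Proof.
have [->|ax] := eqVneq (a x) x; first by rewrite porbit_id.
have xa : a x \in porbit a x by rewrite porbit_step porbit_id.
have E := porbits_tperm_split ax xa.
have := porbits_mul_ge (tperm (a x) x * a) b; rewrite E -mulpA.
by have := porbits_mul_tperm (a * b) (a x) x; rewrite ax /=; case: (_ \in _) => //=; lia.
Qed.

(* If [x] lies on the [p]-cycle of [h0] and [y] does not, the cycle of [h0]
   under [tperm x y * p] is obtained by inserting the cycle of [y] after [x]. *)
Lemma orbit_merge p h0 x y : x \in porbit p h0 -> y \notin porbit p h0 ->
  exists A C, [/\ fingraph.orbit p h0 = A ++ C, A != [::] & last h0 A = x] /\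
    fingraph.orbit (tperm x y * p) h0 = A ++ fingraph.orbit p (p y) ++ C.
Proof.
move=> xh yh; pose q := tperm x y * p.
have memO z w : (z \in fingraph.orbit p w) = (z \in porbit p w).
  by rewrite porbit_fconnect fconnect_orbit.
have cycO z : fcycle p (fingraph.orbit p z) by apply: cycle_orbit; apply: perm_inj.
have uO z := orbit_uniq p z.
have qE z : z != x -> z != y -> q z = p z.
  by move=> zx zy; rewrite permM tpermD // eq_sym.
have qx : q x = p y by rewrite permM tpermL.
have qy : q y = p x by rewrite permM tpermR.
have eqp z r : x \notin belast z r -> y \notin belast z r -> fpath q z r = fpath p z r.
  elim: r z => //= u r IH z; rewrite !inE !negb_or => /andP[xz xr] /andP[yz yr].
  by rewrite IH // qE // eq_sym.
have [r Er] : exists r : seq T, fingraph.orbit p h0 = h0 :: r.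
  by rewrite /fingraph.orbit -orderSpred; eexists.
have [s Es] : exists s : seq T, fingraph.orbit p (p y) = p y :: s.
  by rewrite /fingraph.orbit -orderSpred; eexists.
move: xh yh; rewrite -!memO Er => xh yh.
case/splitPl: xh Er yh => r1 r2 lx Er yh.
exists (h0 :: r1), r2; split; first by [].
have := cycO (p y); have := uO (p y); rewrite Es /= => us; rewrite rcons_path => /andP[ps /eqP ls].
have {}ls : last (p y) s = y by apply: perm_inj ls.
have := cycO h0; have := uO h0; rewrite Er => ur; rewrite /=.
rewrite rcons_cat cat_path => /andP[p1 p2].
have ys : {subset p y :: s <= porbit p y}.
  by move=> z; rewrite -Es memO porbit_sym porbit_step porbit_sym.
have dis z : z \in p y :: s -> z \notin h0 :: r1 ++ r2.
  move=> /ys zy; apply: contra yh; rewrite -Er !memO -!eq_porbit_mem => /eqP <-.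
  by rewrite eq_porbit_mem porbit_sym.
have ul : uniq ((h0 :: r1) ++ (p y :: s) ++ r2).
  rewrite uniq_catCA cat_uniq [uniq (_ :: s)]us ur andbT; apply/hasPn => z; apply: contraL.
  exact: dis.
have cl : fcycle q ((h0 :: r1) ++ (p y :: s) ++ r2).
  have [xr1 yr1] : x \notin belast h0 r1 /\ y \notin belast h0 r1.
    split; last by apply: contra yh => /mem_belast; rewrite -cat_cons mem_cat => ->.
    have : uniq (h0 :: r1) by move: ur; rewrite -cat_cons cat_uniq => /andP[].
    by rewrite lastI rcons_uniq lx => /andP[].
  have [xs ys'] : x \notin belast (p y) s /\ y \notin belast (p y) s.
    split; first by apply/negP => /mem_belast/dis; rewrite -cat_cons mem_cat -lx mem_last.
    by move: us; rewrite -[_ && _]/(uniq (p y :: s)) lastI rcons_uniq ls => /andP[].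
  have [xr2 yr2] : x \notin r2 /\ y \notin r2.
    split; last by apply: contra yh; rewrite -cat_cons mem_cat orbC => ->.
    by move: ur; rewrite -cat_cons cat_uniq => /and3P[_ /hasPn h _]; apply/negP => /h; rewrite -lx mem_last.
  rewrite /= rcons_cat cat_path eqp // p1 lx /= qx eqxx /= rcons_cat cat_path eqp // ps ls /=.
  move: p2; rewrite lx; case: (r2) xr2 yr2 => [|u r'] /=; rewrite ?andbT ?qy //.
  move=> xr2 yr2 /andP[-> p2] /=; rewrite eqp ?belast_rcons //.
by rewrite (fingraph.orbitE cl ul) ?inE ?eqxx //= eqxx rot0.
Qed.

Section Merge.
Variables (p : {perm T}) (h0 x y : T).
Hypotheses (xh : x \in porbit p h0) (yh : y \notin porbit p h0).
Local Notation q := (tperm x y * p).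
Local Notation idx := (findex p h0).
Local Notation idx' := (findex q h0).

Let memO z w : (z \in fingraph.orbit p w) = (z \in porbit p w).
Proof. by rewrite porbit_fconnect fconnect_orbit. Qed.

Let memOp z : (z \in fingraph.orbit p (p y)) = (z \in porbit p y).
Proof. by rewrite memO porbit_sym porbit_step porbit_sym. Qed.

Lemma porbit_merge z :
  (z \in porbit q h0) = (z \in porbit p h0) || (z \in porbit p y).
Proof.
have [A [C [[E _ _] E']]] := orbit_merge xh yh.
rewrite porbit_fconnect fconnect_orbit E' -[z \in porbit p h0]memO E -memOp.
by rewrite !mem_cat; do !case: (z \in _).
Qed.

Let dis z : z \in porbit p y -> z \notin porbit p h0.
Proof.
by move=> zy; apply: contra yh; rewrite -!eq_porbit_mem => /eqP <-;
  rewrite eq_porbit_mem porbit_sym.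
Qed.

Let merge_index : exists A C, let B := fingraph.orbit p (p y) in
  [/\ x \in A, index x A = (size A).-1,
     forall z, idx z = if z \in A then index z A else size A + index z C
   & forall z, idx' z = if z \in A then index z A else
       size A + if z \in B then index z B else size B + index z C]
  /\ fingraph.orbit p h0 = A ++ C.
Proof.
have [A [C [[E A0 lx] E']]] := orbit_merge xh yh.
have u := orbit_uniq p h0; rewrite E in u.
exists A, C; split => //; split.
- by rewrite -lx; case: (A) A0 => // a A' _ /=; rewrite mem_last.
- case: (A) A0 u lx => // a A' _ u <- /=; apply: index_last.
  by move: u; rewrite cat_uniq => /andP[].
- by move=> z; rewrite /findex E index_cat.
- by move=> z; rewrite /findex E' !index_cat.
Qed.

Lemma findex_merge_leq z : idx z <= idx x -> idx' z = idx z.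
Proof.
have [A [C [[xA xi iE iE'] _]]] := merge_index.
rewrite iE' !iE xA; case: ifP => // zA.
have : index x A < size A by rewrite index_mem.
by move=> lt le; have := leq_ltn_trans le lt; rewrite ltnNge leq_addr.
Qed.

Lemma findex_merge_lt z w : z \in porbit p h0 -> w \in porbit p h0 ->
  (idx' z < idx' w) = (idx z < idx w).
Proof.
have [A [C [[xA xi iE iE'] _]]] := merge_index.
have nB v : v \in porbit p h0 -> v \in fingraph.orbit p (p y) = false.
  by rewrite memOp; apply/contraTF/dis.
have ltA v : v \in A -> index v A < size A by rewrite index_mem.
move=> /nB zB /nB wB; rewrite !iE !iE' zB wB.
case: ifP => zA; case: ifP => wA //.
- by have := ltA _ zA; lia.
- by have := ltA _ wA; lia.
- by lia.
Qed.

Lemma findex_merge_inserted z w : z \in porbit p h0 -> w \in porbit p y ->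
  (idx' z < idx' w) = (idx z <= idx x).
Proof.
have [A [C [[xA xi iE iE'] E]]] := merge_index.
move=> zh wy; have wB : w \in fingraph.orbit p (p y) by rewrite memOp.
have zB : z \in fingraph.orbit p (p y) = false by rewrite memOp; apply/contraTF/dis: zh.
have wA : w \in A = false.
  by apply/contraNF: (dis wy) => wA; rewrite -memO E mem_cat wA.
have ltA v : v \in A -> index v A < size A by rewrite index_mem.
have ltB : index w (fingraph.orbit p (p y)) < size (fingraph.orbit p (p y)).
  by rewrite index_mem.
have ltx := ltA _ xA.
rewrite !iE !iE' zB wB wA xA xi.
by case: ifP => zA; [have := ltA _ zA; lia | lia].
Qed.

Lemma findex_merge_last z : z \in porbit p y -> idx' z <= idx' y.
Proof.
have [A [C [[E A0 lx] E']]] := orbit_merge xh yh.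
move=> zy; have zB : z \in fingraph.orbit p (p y) by rewrite memOp.
have yB : y \in fingraph.orbit p (p y) by rewrite memOp porbit_id.
have nA w : w \in porbit p y -> w \in A = false.
  by move=> /dis; rewrite -memO E mem_cat; case: (w \in A).
rewrite /findex E' !index_cat zB yB !nA ?porbit_id // leq_add2l.
have uy := orbit_uniq p (p y).
have cy : fcycle p (fingraph.orbit p (p y)) by apply: cycle_orbit; apply: perm_inj.
have [r Er] : exists r : seq T, fingraph.orbit p (p y) = p y :: r.
  by rewrite /fingraph.orbit -orderSpred; eexists.
have lr : last (p y) r = y.
  by move: cy; rewrite Er /= rcons_path => /andP[_ /eqP/perm_inj].
have iy : index y (p y :: r) = size r.
  by rewrite -{1}lr; apply: index_last; rewrite -Er.
rewrite Er iy -ltnS -[(size r).+1]/(size (p y :: r)) index_mem -Er //.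
Qed.
End Merge.
End PermCycles.

(** A point off the cycle gets the index [order p h0], which no point of the cycle has; so [z] may
    be arbitrary. *)
Lemma findex_inj (T : finType) (p : {perm T}) h0 x z :
  x \in porbit p h0 -> findex p h0 z = findex p h0 x -> z = x.
Proof.
rewrite porbit_fconnect => xh E.
rewrite -(iter_findex xh) -E iter_findex //.
by have := findex_max xh; rewrite -E /findex -size_orbit index_mem fconnect_orbit.
Qed.

(** Agreement at the first [n] points fixes the first [n.+1] of them. The disjunction allows indices
    to be transported from either permutation. *)
Lemma findex_prefix (T : finType) (p q : {perm T}) h0 n :
  n < fingraph.order p h0 -> (forall i, i < n -> p (iter i p h0) = q (iter i p h0)) ->
  n < fingraph.order q h0 /\
  forall z, findex p h0 z <= n \/ findex q h0 z <= n -> findex q h0 z = findex p h0 z.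
Proof.
move=> np pq; have tE : traject p h0 n.+1 = traject q h0 n.+1.
  apply: (@eq_from_nth _ h0); rewrite !size_traject // => i lt.
  rewrite !nth_traject //; elim: i lt => //= i IH lt.
  by rewrite pq ?IH //; apply: ltnW.
have oE r : n < fingraph.order r h0 -> fingraph.orbit r h0 =
    traject r h0 n.+1 ++ traject r (iter n.+1 r h0) (fingraph.order r h0 - n.+1).
  by move=> lt; rewrite /fingraph.orbit -trajectD subnKC.
have nq : n < fingraph.order q h0.
  have := orbit_uniq p h0; rewrite (oE _ np) cat_uniq => /andP[u _].
  rewrite -[n.+1](size_traject p h0) -(size_orbit q h0).
  apply: uniq_leq_size => // z; rewrite tE => /trajectP[i _ ->].
  by rewrite -fconnect_orbit fconnect_iter.
split => // z; rewrite /findex (oE _ np) (oE _ nq) !index_cat -tE size_traject.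
by case: ifP => // _ []; lia.
Qed.

(** * Tours of maps *)

Section Tour.
Local Open Scope group_scope.
Variables (E : finType) (s : {perm E * bool}).
Local Notation H := (E * bool)%type.
Implicit Types (T B : {set E}) (e g : E) (h z x y : H) (X : {set H}).

(* [(e, true)] is the white end of the edge [e], [(e, false)] its black end; [s]
   turns around the vertices. *)
Definition flip h : H := (h.1, ~~ h.2).

Lemma flipK : involutive flip. Proof. by case=> e b; rewrite /flip negbK. Qed.

Lemma flip_neq h : (flip h == h) = false.
Proof. by case: h => e []; rewrite /flip xpair_eqE andbF. Qed.

Lemma eq_or_flip h z : z.1 = h.1 -> z = h \/ z = flip h.
Proof. by case: h z => e b [_ c] /= ->; case: b c => [] []; [left|right|right|left]. Qed.

Definition swap_ends T h := if h.1 \in T then flip h else h.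

Lemma swap_endsK T : involutive (swap_ends T).
Proof. by move=> h; rewrite /swap_ends; case hT: (h.1 \in T); rewrite /= hT ?flipK. Qed.

(* Walks along the boundary of the ribbon subgraph with edge set [T]: at a
   half-edge of [T], cross the edge; then turn around the vertex. *)
Definition tour T : {perm H} := perm (inv_inj (swap_endsK T)) * s.

Lemma tourE T h : tour T h = s (if h.1 \in T then flip h else h).
Proof. by rewrite permM permE. Qed.

Lemma tour0 : tour set0 = s.
Proof. by apply/permP => h; rewrite tourE inE. Qed.

Lemma tour_add T h : h.1 \notin T -> tour (h.1 |: T) = tperm h (flip h) * tour T.
Proof.
move=> hT; apply/permP => z; rewrite tourE permM tourE in_setU1.
case: tpermP => [->|->|/eqP zh /eqP zf] /=.
- by rewrite eqxx /= (negbTE hT).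
- by rewrite eqxx /= (negbTE hT) flipK.
- case: eqP => //= /eq_or_flip[] /eqP E'; first by rewrite E' in zh.
  by rewrite E' in zf.
Qed.

Lemma tour_addK T h : h.1 \notin T -> tperm h (flip h) * tour (h.1 |: T) = tour T.
Proof. by move=> hT; rewrite tour_add // mulgA tperm2 mul1g. Qed.

Lemma leq_tourU T T' : T \subset T' ->
  #|porbits (tour T)| <= #|porbits (tour T')| + #|T' :\: T|.
Proof.
have [n] := ubnP #|T' :\: T|; elim: n T => // n IH T lt sub.
have [E0|[e]] := set_0Vmem (T' :\: T).
  have -> : T = T' by apply/eqP; rewrite eqEsubset sub -setD_eq0 E0 eqxx.
  exact: leq_addr.
rewrite inE => /andP[eT eT'].
have cE : #|T' :\: T| = (#|T' :\: (e |: T)|).+1.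
  rewrite (cardsD1 e) !inE eT eT' /= add1n; congr (_.+1).
  by apply: eq_card => g; rewrite !inE negb_or andbA.
have := IH (e |: T); rewrite cE ltnS in lt; move=> /(_ lt).
rewrite subUset sub1set eT' sub => /(_ isT).
have := leq_porbits_tperm (tour T) (e, true) (e, false).
by rewrite -(@tour_add T (e, true)) //= cE; lia.
Qed.

(** By [leq_tourU], the left side is never smaller than the right one. Equality says that each edge,
    when added, merges two boundary walks, that is, closes no circuit. *)
Definition forest T := #|T| + #|porbits (tour T)| == #|porbits s|.

Lemma forest_sub T T' : T \subset T' -> forest T' -> forest T.
Proof.
move=> sub /eqP fT; have := leq_tourU sub; have := leq_tourU (sub0set T).
rewrite tour0 setD0 /forest => h1 h2; have := cardsD T' T.
by rewrite (setIidPr sub) => h3; have := subset_leq_card sub; move: fT h1 h2 h3; lia.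
Qed.

(** Removing the edge leaves a forest and so gains a boundary walk: both ends were on the walk that
    splits. *)
Lemma forest_flip T h : forest T -> h.1 \in T -> flip h \in porbit (tour T) h.
Proof.
move=> fT hT; have f0 := forest_sub (subsetDl T [set h.1]) fT.
have h0 : h.1 \notin T :\ h.1 by rewrite !inE eqxx.
have ET := setD1K hT; move: (T :\ h.1) f0 h0 ET => T0 f0 h0 ET.
move: fT f0; rewrite /forest -ET cardsU1 h0.
have := porbits_mul_tperm (tour (h.1 |: T0)) h (flip h).
rewrite /= tour_addK // eq_sym flip_neq /= porbit_sym.
by case: (_ \in porbit _ _) => //=; lia.
Qed.

(** Thus a boundary walk of a forest contains every vertex that it visits entirely. *)
Lemma forest_step T h : forest T -> s h \in porbit (tour T) h.
Proof.
move=> fT; have -> : s h = tour T (swap_ends T h).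
  by rewrite tourE -/(swap_ends T _) swap_endsK.
rewrite porbit_step /swap_ends; case: ifP => hT; last exact: porbit_id.
exact: forest_flip.
Qed.

(** These are the unions of connected components of the map without [B]; on a finite set, closure
    under [s] in one direction is enough. *)
Definition stable B X :=
  [forall h in X, (s h \in X) && ((h.1 \notin B) ==> (flip h \in X))].

Lemma stableP B X : reflect ((forall h, h \in X -> s h \in X) /\
  (forall h, h \in X -> h.1 \notin B -> flip h \in X)) (stable B X).
Proof.
apply: (iffP forall_inP) => [hX|[sX fX] h hX].
  by split=> h /hX /andP[] // _ /implyP.
by rewrite sX //=; apply/implyP; apply: fX.
Qed.

Lemma stable_tour B T X h z : stable B X -> [disjoint T & B] ->
  z \in porbit (tour T) h -> (h \in X) = (z \in X).
Proof.
move=> /stableP[sX fX] TB; apply: porbit_stable => y yX.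
by rewrite tourE; apply: sX; case: ifP => // /(disjointFr TB)/negbT; apply: fX.
Qed.

Lemma stable_flip B X h : stable B X -> h.1 \notin B -> (flip h \in X) = (h \in X).
Proof.
move=> /stableP[_ fX] hB; apply/idP/idP => hX; last exact: fX.
by rewrite -[h]flipK fX.
Qed.

(* The map stays connected when the edges of [B] are deleted. *)
Definition connected_off B :=
  [forall X : {set H}, (X != set0) && stable B X ==> (X == setT)].

Lemma connected_offP B : reflect
  (forall X h, h \in X -> stable B X -> X = setT) (connected_off B).
Proof.
apply: (iffP forallP) => [c X h hX sX|c X].
  by apply/eqP; apply: (implyP (c X)); rewrite sX andbT; apply/set0Pn; exists h.
by apply/implyP => /andP[/set0Pn[h hX] sX]; apply/eqP; exact: (c X h).
Qed.
End Tour.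

(** * Jaeger trees *)

Section TreeExpansion.
Variables (E : finType) (s : {perm E * bool}) (h0 : E * bool).
Local Notation H := (E * bool)%type.
Implicit Types (T B : {set E}) (e g : E) (h z x y : H) (X : {set H}).
Local Notation tour := (tour s).
Local Notation blob T := (porbit (tour T) h0).
Local Notation idx T h := (findex (tour T) h0 h).

(* The Jaeger trees of Kalman and Tothmeresz; [|T| + 1] is the number of
   vertices. *)
Definition jaeger T :=
  [&& [forall h, h \in blob T], #|T|.+1 == #|porbits s| &
      [forall (g | g \notin T), idx T (g, false) < idx T (g, true)]].

(* For an edge [e] of a tree [T]: it is met at its black end first, and another
   edge crosses, in the opposite direction, the cut defined by [e]. *)
Definition flippable T e := [exists (g | g \notin T),
  (idx T (e, false) < idx T (g, false) < idx T (e, true)) &&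
  (idx T (e, true) < idx T (g, true))].

Lemma full_porbits T : [forall h, h \in blob T] -> #|porbits (tour T)| = 1.
Proof.
move=> /forallP full; rewrite (_ : porbits _ = [set blob T]) ?cards1 //.
apply/setP => X; rewrite inE; apply/imsetP/eqP => [[h _ ->]|->]; last by exists h0.
by apply/eqP; rewrite eq_porbit_mem.
Qed.

Lemma jaeger_forest T : jaeger T -> forest s T.
Proof. by case/and3P => /full_porbits E1 cT _; rewrite /forest E1 addn1. Qed.

Lemma jaeger_blob T h : jaeger T -> h \in blob T.
Proof. by case/and3P => /forallP. Qed.

Lemma jaeger_lt T g : jaeger T -> g \notin T -> idx T (g, false) < idx T (g, true).
Proof. by case/and3P => _ _ /forall_inP; apply. Qed.

Lemma jaeger_connected T B : jaeger T -> [disjoint T & B] -> connected_off s B.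
Proof.
move=> jT TB; apply/connected_offP => X h hX sX; apply/setP => z; rewrite inE.
rewrite -(stable_tour sX TB (jaeger_blob z jT)).
by rewrite (stable_tour sX TB (jaeger_blob h jT)).
Qed.

Lemma findex_notin (p : {perm H}) z : z \notin porbit p h0 ->
  findex p h0 z = fingraph.order p h0.
Proof.
by rewrite porbit_fconnect fconnect_orbit => zn; rewrite /findex memNindex ?size_orbit.
Qed.

Lemma findex_in (p : {perm H}) z : z \in porbit p h0 ->
  findex p h0 z < fingraph.order p h0.
Proof. by rewrite porbit_fconnect; apply: findex_max. Qed.

(** * The first undecided half-edge and the Jaeger trees through it *)

Section FirstUndecided.
Variables (T B : {set E}) (h : H).
Hypotheses (hT : h.1 \notin T) (hB : h.1 \notin B) (hblob : h \in blob T).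
Hypothesis hmin : forall z, z.1 \notin T -> z.1 \notin B -> idx T h <= idx T z.

Lemma undecided_lt z : z.1 \notin T -> z.1 \notin B -> z != h -> idx T h < idx T z.
Proof.
move=> zT zB zh; rewrite ltn_neqAle hmin // andbT.
by apply: contra zh => /eqP /esym/(findex_inj hblob) ->.
Qed.

(** Before [h], the tour of [T] meets only edges of [T] and [B], where [T'] makes the same
    choices. *)
Lemma tour_prefix T' : T \subset T' -> [disjoint T' & B] ->
  h \in blob T' /\ forall z, idx T z <= idx T h \/ idx T' z <= idx T h ->
    idx T' z = idx T z.
Proof.
move=> sub TB; have lt := findex_in hblob.
have [|lt' P] := findex_prefix (q := tour T') lt.
  move=> i lti; pose z := iter i (tour T) h0.
  have zi : idx T z = i by apply: findex_iter; apply: ltn_trans lti lt.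
  rewrite -/z !tourE; case zT: (z.1 \in T); first by rewrite (subsetP sub).
  case zB: (z.1 \in B); first by rewrite (disjointFl TB).
  by have := hmin (negbT zT) (negbT zB); rewrite zi leqNgt lti.
split => //; have E0 := P h (or_introl (leqnn _)).
by apply/negPn/negP => /findex_notin E1; move: lt'; rewrite -E1 E0 ltnn.
Qed.

Lemma prefix_idx_h T' : T \subset T' -> [disjoint T' & B] -> idx T' h = idx T h.
Proof. by move=> sub TB; apply: (tour_prefix sub TB).2; left. Qed.

Lemma prefix_undecided T' z : T \subset T' -> [disjoint T' & B] ->
  z.1 \notin T -> z.1 \notin B -> z != h -> idx T h < idx T' z.
Proof.
move=> sub TB zT zB zh; rewrite ltnNge; apply/negP => le.
have := (tour_prefix sub TB).2 z (or_intror le) => E1.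
by move: le; rewrite E1 leqNgt undecided_lt.
Qed.

(** With both ends on one boundary walk, adding the edge splits this walk instead of merging two. *)
Lemma jaeger_loop T' : jaeger T' -> T \subset T' -> flip h \in blob T ->
  h.1 \notin T'.
Proof.
move=> /jaeger_forest fT' sub fh; apply/negP => hT'.
have sub1 : h.1 |: T \subset T' by rewrite subUset sub1set hT'.
have := forest_sub sub1 fT'; have := forest_sub sub fT'.
rewrite /forest cardsU1 hT tour_add // => f1.
rewrite porbits_tperm_split ?(eq_sym h) ?flip_neq //; first by move: f1; lia.
by move: hblob fh; rewrite -!eq_porbit_mem => /eqP -> /eqP ->.
Qed.

(** Otherwise the edge would have to be met at its black end first, but the tour of [T'] reaches the
    white end [h] before any other undecided half-edge. *)
Lemma jaeger_white T' : h.2 -> jaeger T' -> T \subset T' -> [disjoint T' & B] ->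
  h.1 \in T'.
Proof.
move=> h2 jT' sub TB; apply/negPn/negP => hT'; have := jaeger_lt jT' hT'.
have -> : (h.1, true) = h by rewrite -h2 -surjective_pairing.
rewrite prefix_idx_h // ltnNge => /negP[]; apply: ltnW.
by apply: prefix_undecided => //; case: (h) h2 => e b /= ->; rewrite xpair_eqE andbF.
Qed.

(* Removing [h.1] from the tree [T'] splits the tour into the part [Q] walked
   between the two ends of [h.1] and the rest. *)
Section Split.
Variable T' : {set E}.
Hypotheses (jT' : jaeger T') (sub : T \subset T') (TB : [disjoint T' & B]).
Hypothesis hT' : h.1 \in T'.
Let T0 := T' :\ h.1.
Let Q := porbit (tour T0) (flip h).

Let hT0 : h.1 \notin T0. Proof. by rewrite !inE eqxx. Qed.

Let tT0 : tour T' = (tperm h (flip h) * tour T0)%g.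
Proof. by rewrite -tour_add ?setD1K. Qed.

Let fT0 : forest s T0. Proof. exact: forest_sub (subsetDl _ _) (jaeger_forest jT'). Qed.

Let h_T0 : h \in blob T0.
Proof.
have [hb _] := tour_prefix sub TB.
have lt := findex_in hb; have := findex_prefix (q := tour T0) lt.
case=> [i lti|lt' P].
  pose z := iter i (tour T') h0.
  have zi : idx T' z = i by apply: findex_iter; apply: ltn_trans lti lt.
  rewrite -/z !tourE !inE; case: eqP => //= zh.
  have zT : z.1 \notin T by rewrite zh. have zB : z.1 \notin B by rewrite zh.
  have [zE|zE] := eqVneq z h; first by move: lti; rewrite -zE zi ltnn.
  have := prefix_undecided sub TB zT zB zE.
  by rewrite zi -(prefix_idx_h sub TB) => /ltnW; rewrite leqNgt lti.
have E0 := P h (or_introl (leqnn _)).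
by apply/negPn/negP => /findex_notin E1; move: lt'; rewrite -E1 E0 ltnn.
Qed.

Let fh_T0 : flip h \notin blob T0.
Proof.
apply/negP => fh; have hf : h \in porbit (tour T0) (flip h).
  by move: h_T0 fh; rewrite -!eq_porbit_mem => /eqP -> /eqP ->.
have := jaeger_forest jT'; have := fT0; rewrite /forest (cardsD1 h.1 T') hT'.
have := porbits_tperm_split _ hf; rewrite eq_sym flip_neq -tT0 => /(_ isT) ->.
rewrite -/T0 add1n addSn addnS => /eqP <-.
by rewrite -addn2 -[X in _ == X]addn0 eqn_add2l.
Qed.

Lemma in_split z : z \in Q -> idx T h < idx T' z <= idx T' (flip h).
Proof.
move=> zQ; rewrite tT0 (findex_merge_last h_T0 fh_T0 zQ) andbT -tT0.
by rewrite -(prefix_idx_h sub TB) tT0 (findex_merge_inserted h_T0 fh_T0 h_T0 zQ).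
Qed.

Lemma out_split z : z \notin Q -> idx T h < idx T' z -> idx T' (flip h) < idx T' z.
Proof.
move=> zQ lt; have := jaeger_blob z jT'.
rewrite tT0 (porbit_merge h_T0 fh_T0) (negbTE zQ) orbF => zh.
rewrite -tT0 ltn_neqAle leqNgt andbC tT0.
rewrite (findex_merge_inserted h_T0 fh_T0 zh (porbit_id _ _)).
apply/andP; split.
  apply/negP => le; have E1 := findex_merge_leq h_T0 fh_T0 le.
  have E2 := findex_merge_leq h_T0 fh_T0 (leqnn _).
  by move: lt; rewrite -(prefix_idx_h sub TB) tT0 E1 E2 ltnNge le.
rewrite -tT0; apply: contra zQ => /eqP/findex_inj <-; last exact: jaeger_blob.
exact: porbit_id.
Qed.

Let T0B : [disjoint T0 & h.1 |: B].
Proof.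
rewrite -setI_eq0 setIUr setU_eq0 !setI_eq0 disjoint_sym disjoints1 hT0 /=.
by apply: disjointWl TB; apply: subsetDl.
Qed.

(** By connectedness some edge other than [h.1] and outside [B] leaves [Q]. It is not in [T'], whose
    other edges stay on one walk of [T0]. Both its ends come after [h], one before and one after
    [flip h], and the Jaeger condition makes the earlier one black. *)
Lemma connected_flippable : ~~ h.2 -> connected_off s (h.1 |: B) -> flippable T' h.1.
Proof.
move=> h2 /connected_offP cB.
have hE : (h.1, false) = h by rewrite -(negbTE h2) -surjective_pairing.
have fE : (h.1, true) = flip h by rewrite /flip h2.
have /existsP[z /and4P[zQ zh zB fz]] :
    [exists z, [&& z \in Q, z.1 != h.1, z.1 \notin B & flip z \notin Q]].
  apply: contraNT fh_T0; rewrite negb_exists => /forallP hz.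
  suff QT : Q = [set: H].
    have : h \in Q by rewrite QT inE.
    by move: h_T0; rewrite /Q -!eq_porbit_mem => /eqP <- /eqP ->.
  apply: (cB _ (flip h)); first exact: porbit_id.
  apply/stableP; split=> z zQ.
    have := forest_step z fT0; rewrite porbit_sym.
    by move: zQ; rewrite /Q -!eq_porbit_mem => /eqP -> /eqP ->.
  rewrite in_setU1 negb_or => /andP[zh zB].
  by move: (hz z); rewrite zQ zh zB /= negbK.
have zT : z.1 \notin T'.
  apply: contra fz => zT'; have zT0 : z.1 \in T0 by rewrite !inE zh.
  have := forest_flip fT0 zT0; rewrite porbit_sym.
  by move: zQ; rewrite /Q -!eq_porbit_mem => /eqP -> /eqP ->.
have zT1 : z.1 \notin T by apply: contra zT; apply: (subsetP sub).
have nh w : w.1 = z.1 -> w != h by move=> E1; apply: contraNneq zh => <-; rewrite E1.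
have nf w : w.1 = z.1 -> w != flip h by move=> E1; apply: contraNneq zh => E2; rewrite -E1 E2.
have lt w : w.1 = z.1 -> idx T h < idx T' w.
  by move=> E1; apply: prefix_undecided; rewrite ?E1 // nh.
have ltz := jaeger_lt jT' zT.
have inz w : w.1 = z.1 -> w \in Q -> idx T' w < idx T' (flip h).
  move=> E1 /in_split /andP[_]; rewrite leq_eqVlt => /orP[/eqP/findex_inj|//].
  by move=> /(_ (jaeger_blob _ jT')) /eqP; rewrite (negbTE (nf _ E1)).
have outz w : w.1 = z.1 -> w \notin Q -> idx T' (flip h) < idx T' w.
  by move=> E1 wQ; apply: out_split => //; apply: lt.
have zf : z = (z.1, false).
  case: (z) zQ fz ltz inz outz => e [] //= zQ fz ltz inz outz; exfalso.
  have lt1 := ltn_trans (outz (e, false) erefl fz) ltz.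
  by have := ltn_trans lt1 (inz (e, true) erefl zQ); rewrite ltnn.
have fzE : (z.1, true) = flip z by rewrite {2}zf.
apply/existsP; exists z.1; rewrite zT hE fE fzE -zf prefix_idx_h //=.
by rewrite lt // inz // outz.
Qed.

Hypothesis blackB : forall g, g \in B -> idx T (g, false) < idx T h.

(** The interlacing edge is not in [B], whose black ends all precede [h]. It joins [Q] to the blob
    of [T0], and these two walks exhaust the half-edges. *)
Lemma flippable_connected : flippable T' h.1 -> ~~ h.2 -> connected_off s (h.1 |: B).
Proof.
move=> /existsP[g /and3P[gT' /andP[lt1 lt2] lt3]] h2.
have hE : (h.1, false) = h by rewrite -(negbTE h2) -surjective_pairing.
have fE : (h.1, true) = flip h by rewrite /flip h2.
move: lt1 lt2 lt3; rewrite hE fE prefix_idx_h // => lt1 lt2 lt3.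
have gB : g \notin B.
  apply/negP => gB; have lt := blackB gB.
  have := (tour_prefix sub TB).2 _ (or_introl (ltnW lt)) => E1.
  by move: lt1; rewrite E1 ltnNge (ltnW lt).
have gh : g != h.1 by apply: contraNneq gT' => ->.
have gQ : (g, false) \in Q.
  by apply: contraLR lt2 => gQ; rewrite -leqNgt ltnW // out_split.
have gQ' : (g, true) \notin Q.
  by apply: contraL lt3 => /in_split/andP[_]; rewrite -leqNgt.
have gb : (g, true) \in blob T0.
  by have := jaeger_blob (g, true) jT'; rewrite tT0 (porbit_merge h_T0 fh_T0) (negbTE gQ') orbF.
apply/connected_offP => X x xX sX.
have gX : ((g, true) \in X) = ((g, false) \in X).
  by rewrite -(stable_flip (h := (g, false)) sX) // !inE negb_or gh gB.
have QX z : z \in Q -> (z \in X) = ((g, true) \in X).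
  by move=> zQ; rewrite gX -!(stable_tour sX T0B zQ) (stable_tour sX T0B gQ).
have bX z : z \in blob T0 -> (z \in X) = ((g, true) \in X).
  by move=> zb; rewrite -!(stable_tour sX T0B zb) (stable_tour sX T0B gb).
have zX z : (z \in X) = ((g, true) \in X).
  have := jaeger_blob z jT'; rewrite tT0 (porbit_merge h_T0 fh_T0).
  by case/orP; [apply: bX | apply: QX].
by apply/setP => z; rewrite zX -(zX x) xX inE.
Qed.
End Split.
End FirstUndecided.
End TreeExpansion.

(** * Exploration of a coloured map *)

Section Heights.
Variables (E : finType) (s : {perm E * bool}) (h0 : E * bool).
Local Notation H := (E * bool)%type.
Implicit Types (T B : {set E}) (e g : E) (h z x y : H) (X : {set H}).
Local Notation tour := (tour s).
Local Notation blob T := (porbit (tour T) h0).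
Local Notation idx T h := (findex (tour T) h0 h).

Variable psi : H -> nat.
Hypothesis psi_s : forall h, psi (s h) = psi h.
Hypothesis psi_neq : forall e, psi (e, true) != psi (e, false).

Definition good_edge e := psi (e, true) < psi (e, false).

Definition outer_step T B y z := (y \notin blob T) &&
  ((z == s y) || [&& y.1 \notin T, y.1 \notin B & z == flip y]).

(* Some path leaves the blob [T] through [h] and comes back at [z]. *)
Definition linked T B h z := connect (outer_step T B) (flip h) z.

(* A stage of the walk: the edges of [T] have been crossed, those of [B] have been
   met at their black ends and deleted. Along the part of the blob [T] that
   remains to be walked, heights decrease between half-edges that are connected
   outside the blob. *)
Record exploration T B : Prop := Exploration {
  expl_forest : forest s T;
  expl_disj : [disjoint T & B];
  expl_blob : forall h, h.1 \in T -> h \in blob T;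
  expl_black : forall g, g \in B -> idx T (g, false) < idx T (g, true) /\
    forall z, z.1 \notin T -> z.1 \notin B -> idx T (g, false) < idx T z;
  expl_conn : connected_off s B;
  expl_psi : forall h z, h \in blob T -> z \in blob T ->
    h.1 \notin T -> h.1 \notin B -> z.1 \notin T -> z.1 \notin B ->
    idx T h < idx T z -> linked T B h z -> psi z <= psi h }.

(** The initial blob is the vertex of [h0], on which [psi] is constant. *)
Lemma exploration0 : connected_off s set0 -> exploration set0 set0.
Proof.
move=> c0; split => //.
- by rewrite /forest tour0 cards0.
- by rewrite -setI_eq0 set0I.
- by move=> h; rewrite inE.
- by move=> g; rewrite inE.
- have psiE h : h \in blob set0 -> psi h = psi h0.
    rewrite tour0 => hb.
    have sX z : z \in [set z | psi z == psi h0] -> s z \in [set z | psi z == psi h0].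
      by rewrite !inE psi_s.
    have := porbit_stable sX hb; rewrite !inE eqxx => /esym/eqP -> //.
  by move=> h z /psiE -> /psiE ->.
Qed.

Section Step.
Variables (T B : {set E}) (h : H).
Hypothesis expl : exploration T B.
Hypotheses (hT : h.1 \notin T) (hB : h.1 \notin B) (hblob : h \in blob T).
Hypothesis hmin : forall z, z.1 \notin T -> z.1 \notin B -> idx T h <= idx T z.

Let und_lt := undecided_lt hblob hmin.

(** Deleting an edge can only destroy links, so the condition on heights survives. *)
Lemma exploration_delete : ~~ h.2 -> connected_off s (h.1 |: B) ->
  exploration T (h.1 |: B).
Proof.
move=> h2 cB; have [fT TB bT blB _ psiT] := expl.
have hE : (h.1, false) = h by rewrite -(negbTE h2) -surjective_pairing.
split => //.
- by rewrite -setI_eq0 setIUr setU_eq0 !setI_eq0 disjoint_sym disjoints1 hT.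
- move=> g; rewrite in_setU1 => /orP[/eqP ->|gB]; last first.
    have [lt1 lt2] := blB g gB; split=> // z zT; rewrite in_setU1 negb_or => /andP[_].
    exact: lt2.
  rewrite hE; split.
    by apply: und_lt => //; rewrite -{2}hE xpair_eqE andbF.
  move=> z zT; rewrite in_setU1 negb_or => /andP[zh zB]; apply: und_lt => //.
  by apply: contraNneq zh => ->.
- move=> x z xb zb xT; rewrite !in_setU1 !negb_or => /andP[_ xB] zT /andP[_ zB] lt L.
  apply: psiT => //; apply: connect_sub L => u v /andP[ub uv]; apply: connect1.
  rewrite /outer_step ub; case/orP: uv => [->//|/and3P[uT]].
  by rewrite in_setU1 negb_or => /andP[_ ->] ->; rewrite uT orbT.
Qed.

Lemma loop_connected : flip h \in blob T -> connected_off s (h.1 |: B).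
Proof.
move=> fb; have [fT TB _ _ /connected_offP cB _] := expl.
have TB' : [disjoint T & h.1 |: B].
  by rewrite -setI_eq0 setIUr setU_eq0 !setI_eq0 disjoint_sym disjoints1 hT.
apply/connected_offP => X x xX sX; apply: (cB X x xX).
have /stableP[sX1 sX2] := sX; apply/stableP; split=> // z zX zB.
have [zh|zh] := eqVneq z.1 h.1; last by apply: sX2; rewrite // in_setU1 negb_or zh.
have h0X : (h0 \in X) by case: (eq_or_flip zh) zX => -> zX;
  [rewrite (stable_tour sX TB' hblob) | rewrite (stable_tour sX TB' fb)].
case: (eq_or_flip zh) => ->; rewrite ?flipK.
  by rewrite -(stable_tour sX TB' fb).
by rewrite -(stable_tour sX TB' hblob).
Qed.

(** The empty path links [h] to [flip h]: for a loop, the invariant already knows the order of the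
    two heights. *)
Lemma loop_psi : flip h \in blob T -> psi (flip h) <= psi h.
Proof.
move=> fb; have [_ _ _ _ _ psiT] := expl; apply: psiT => //.
  by apply: und_lt => //; rewrite flip_neq.
exact: connect0.
Qed.

Section Contract.
Hypothesis fh : flip h \notin blob T.
Let Q := porbit (tour T) (flip h).
Let T1 := h.1 |: T.

Let tT1 : tour T1 = (tperm h (flip h) * tour T)%g.
Proof. exact: tour_add. Qed.

Let blobT1 z : (z \in blob T1) = (z \in blob T) || (z \in Q).
Proof. by rewrite tT1 (porbit_merge hblob fh). Qed.

Let Qout z : z \in Q -> z \notin blob T.
Proof.
by move=> zQ; apply: contra fh; move: zQ; rewrite /Q -!eq_porbit_mem => /eqP ->.
Qed.

Let tourQ z : z \in Q -> tour T z = s z.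
Proof.
move=> zQ; rewrite tourE ifN //; apply: contra (Qout zQ).
exact: (expl_blob expl).
Qed.

Let Qstep (P : pred H) : (forall z, z \in Q -> P z -> P (s z)) ->
  P (flip h) -> forall z, z \in Q -> P z.
Proof.
move=> PQ P0 z zQ; have: z \in [set z in Q | P z].
  apply: (subsetP (sub_porbit _ _)) zQ => [y|]; last by rewrite inE porbit_id.
  rewrite !inE => /andP[yQ Py]; rewrite porbit_step yQ tourQ //.
  exact: PQ.
by rewrite inE => /andP[].
Qed.

Let psiQ z : z \in Q -> psi z = psi (flip h).
Proof.
move=> zQ; apply/eqP; move: z zQ; apply: Qstep => // z _.
by rewrite psi_s.
Qed.

Let linkQ z : z \in Q -> connect (outer_step T B) (flip h) z.
Proof.
move: z; apply: Qstep => // z zQ /connect_trans; apply; apply: connect1.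
by rewrite /outer_step Qout // eqxx.
Qed.

Let TB1 : [disjoint T1 & B].
Proof.
have [_ TB _ _ _ _] := expl.
by rewrite -setI_eq0 setIUl setU_eq0 !setI_eq0 disjoints1 hB.
Qed.

(** The vertex [Q] of [flip h] is inserted right after [h]. The delicate links go from [Q] back to
    the old blob: either [Q] is higher than [h], which is linked to the same places through [Q], or
    such a link would be a detour around an edge whose deletion disconnects. *)
Lemma exploration_contract :
  psi h < psi (flip h) \/ ~~ connected_off s (h.1 |: B) -> exploration T1 B.
Proof.
move=> hyp; have [fT TB bT blB cB psiT] := expl.
have subT1 : T \subset T1 by apply: subsetUr.
split => //.
- move: fT; rewrite /forest cardsU1 hT tT1.
  have := porbits_mul_tperm (tour T) h (flip h); rewrite -tT1 -/T1 eq_sym flip_neq /=.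
  have -> : h \notin porbit (tour T) (flip h).
    by apply: contra fh; rewrite -/Q => hQ; move: hblob (Qout hQ) => ->.
  by rewrite -tT1; lia.
- move=> z; rewrite in_setU1 blobT1 => /orP[/eqP/eq_or_flip[] ->|/bT -> //].
    by rewrite hblob.
  by rewrite porbit_id orbT.
- move=> g gB; have [lt1 lt2] := blB g gB.
  have lth := lt2 h hT hB.
  have pre := (tour_prefix hblob hmin subT1 TB1).2.
  rewrite (pre (g, false) (or_introl (ltnW lth))); split.
    rewrite ltnNge; apply/negP => le; have E1 := pre (g, true) (or_intror (leq_trans le (ltnW lth))).
    by move: le; rewrite E1 leqNgt lt1.
  move=> z; rewrite in_setU1 negb_or => /andP[zh zT] zB; apply: ltn_trans lth _.
  by apply: (prefix_undecided hblob hmin) => //; apply: contraNneq zh => ->.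
- move=> x z; rewrite !blobT1 => xb zb.
  rewrite !in_setU1 !negb_or => /andP[xh xT] xB /andP[zh zT] zB lt L.
  have outer u : u \notin blob T1 -> u \notin blob T by rewrite blobT1 negb_or => /andP[].
  have L' : linked T B x z.
    apply: connect_sub L => u v /andP[ub uv]; apply: connect1.
    rewrite /outer_step outer //; case/orP: uv => [->//|/and3P[uT]].
    by move: uT; rewrite in_setU1 negb_or => /andP[_ ->] -> ->; rewrite orbT.
  have zneh : z != h by apply: contraNneq zh => ->.
  case/orP: xb => [xb|xQ]; case/orP: zb => [zb|zQ].
  + apply: psiT => //.
    by move: lt; rewrite tT1 (findex_merge_lt hblob fh).
  (* Preceding [Q] means coming no later than [h], and the only half-edge that was undecided there
     is [h] itself, now crossed. *)
  + move: lt; rewrite tT1 (findex_merge_inserted hblob fh xb zQ) => le.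
    have := und_lt xT xB; rewrite ltnNge le; case: eqVneq => [xE|_ /(_ isT)//].
    by rewrite xE eqxx in xh.
  + case: hyp => [lth|nc].
      rewrite (psiQ xQ); apply: leq_trans (ltnW lth); apply: psiT => //; first exact: und_lt.
      apply: connect_trans (linkQ xQ) (connect_trans (connect1 _) L').
      by rewrite /outer_step (Qout xQ) xT xB eqxx orbT.
    exfalso; move/negP: nc; apply; apply/connected_offP => Y y yY sY.
    have TB' : [disjoint T & h.1 |: B].
      by rewrite -setI_eq0 setIUr setU_eq0 !setI_eq0 disjoint_sym disjoints1 hT.
    have YL u v : connect (outer_step T1 B) u v -> (u \in Y) = (v \in Y).
      move=> /connectP[p]; elim: p u => [u _ ->//|w p IH u] /= /andP[st /IH P] /P <-.
      case/andP: st => _ /orP[/eqP ->|].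
        rewrite -[u \in Y]/(u \in Y); have := forest_step u fT => us.
        by rewrite (stable_tour sY TB' us).
      case/and3P; rewrite in_setU1 negb_or => /andP[uh uT] uB /eqP ->.
      by rewrite (stable_flip sY) // in_setU1 negb_or uh.
    have xf : (x \in Y) = (flip h \in Y) by rewrite -(stable_tour sY TB' xQ).
    have zf : (z \in Y) = (h \in Y).
      by rewrite -(stable_tour sY TB' zb) (stable_tour sY TB' hblob).
    have xz : (x \in Y) = (z \in Y).
      rewrite -(YL _ _ L) (stable_flip sY) // in_setU1 negb_or xh //.
    apply: (elimT (connected_offP _ _) cB Y y yY); apply/stableP.
    have /stableP[sY1 sY2] := sY; split=> // u uY uB.
    have [uh|uh] := eqVneq u.1 h.1; last by apply: sY2; rewrite // in_setU1 negb_or uh.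
    case: (eq_or_flip uh) uY => ->; rewrite ?flipK.
      by rewrite -zf -xz xf.
    by rewrite -xf xz zf.
  + by rewrite (psiQ xQ) (psiQ zQ).
Qed.
End Contract.
End Step.
End Heights.

(** * Expansion over forests *)

Section Expansion.
Variables (E : finType) (s : {perm E * bool}) (h0 : E * bool).
Local Notation H := (E * bool)%type.
Implicit Types (T B V : {set E}) (e g : E) (h z x y : H) (X : {set H}).
Local Notation tour := (tour s).
Local Notation blob T := (porbit (tour T) h0).
Local Notation idx T h := (findex (tour T) h0 h).
Variable R : comNzRingType.
Variable psi : H -> nat.
Hypothesis psi_s : forall h, psi (s h) = psi h.
Hypothesis psi_neq : forall e, psi (e, true) != psi (e, false).
Local Notation good := (good_edge psi).
Local Notation jaeger := (jaeger s h0).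
Local Notation flippable := (flippable s h0).

(** For a flippable edge this is [good e - 1]: the edge is kept with its inequality or removed with
    a sign. *)
Definition tree_weight T e : R :=
  if flippable T e then (- (~~ good e)%:R)%R else (good e)%:R%R.

Lemma natr_and (a b : bool) : ((a && b)%:R = a%:R * b%:R :> R)%R.
Proof. by case: a; rewrite ?mul1r ?mul0r. Qed.

(* Computed below by branching at the first undecided half-edge of the tour. *)
Definition branch_sum T B : R :=
  (\sum_(T' | [&& jaeger T', T \subset T' & [disjoint T' & B]])
     \prod_(e in T' :\: T) tree_weight T' e)%R.

Lemma branch_sum_deleted T B e : e \notin T -> e \notin B ->
  (forall T', jaeger T' -> T \subset T' -> [disjoint T' & B] -> e \notin T') ->
  branch_sum T B = branch_sum T (e |: B).
Proof.
move=> eT eB hyp; apply: eq_bigl => T'.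
have [jT'|//] := boolP (jaeger T'); have [sub|//] := boolP (T \subset T').
rewrite /= -[in RHS]setI_eq0 setIUr setU_eq0 !setI_eq0 disjoint_sym (disjoint_sym T') disjoints1.
by case: (boolP [disjoint B & T']) => TB; rewrite ?andbF // (hyp T') // disjoint_sym.
Qed.

Lemma branch_sum_included T B e (c : R) : e \notin T -> e \notin B ->
  (forall T', jaeger T' -> T \subset T' -> [disjoint T' & B] ->
     e \in T' -> tree_weight T' e = c) ->
  (\sum_(T' | [&& jaeger T', T \subset T', [disjoint T' & B] & e \in T'])
     \prod_(g in T' :\: T) tree_weight T' g = c * branch_sum (e |: T) B)%R.
Proof.
move=> eT eB hyp; rewrite big_distrr /=; apply: eq_big => [T'|T' /and4P[jT' sub TB eT']].
  by rewrite subUset sub1set; case: (jaeger T') (T \subset T') (e \in T') => [] [] [];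
    rewrite ?andbT ?andbF.
rewrite (bigD1 e) ?inE ?eT ?eT' //= hyp //; congr (_ * _)%R.
by apply: eq_bigl => g; rewrite !inE negb_or; case: (g == e); rewrite ?andbF ?andbT.
Qed.

Lemma branch_sum_split T B e : e \notin B ->
  (branch_sum T B = branch_sum T (e |: B) +
   \sum_(T' | [&& jaeger T', T \subset T', [disjoint T' & B] & e \in T'])
     \prod_(g in T' :\: T) tree_weight T' g)%R.
Proof.
move=> eB; rewrite [LHS](bigID (fun T' : {set E} => e \notin T')) /=; congr (_ + _)%R.
  apply: eq_bigl => T'.
  rewrite -[in RHS]setI_eq0 setIUr setU_eq0 !setI_eq0 (disjoint_sym _ [set e]) disjoints1.
  by rewrite -!andbA; do !bool_congr; rewrite andbC.
by apply: eq_bigl => T'; rewrite negbK -!andbA.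
Qed.

Lemma forall_undecided T B e : e \notin T -> e \notin B ->
  [forall g, (g \notin T) && (g \notin B) ==> good g] =
  good e && [forall g, (g \notin e |: T) && (g \notin B) ==> good g].
Proof.
move=> eT eB; apply/forallP/andP => [hyp|[ge /forallP hyp] g].
  split; first by have := hyp e; rewrite eT eB.
  apply/forallP => g; have := hyp g; rewrite in_setU1 negb_or.
  by case: (g == e) => //=.
have [->|ge'] := eqVneq g e; first by rewrite ge implybT.
by have := hyp g; rewrite in_setU1 negb_or ge'.
Qed.

Lemma forall_undecidedC T B e :
  [forall g, (g \notin e |: T) && (g \notin B) ==> good g] =
  [forall g, (g \notin T) && (g \notin e |: B) ==> good g].
Proof.
by apply: eq_forallb => g; rewrite !in_setU1 !negb_or; case: (g == e); rewrite ?andbF.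
Qed.

(** Induction on the number of undecided edges, branching at the first undecided half-edge [h]. Only
    for a black [h] outside loops, with a connected map after deletion, can both branches
    contribute; then the contracted one vanishes for a good edge and cancels the other for a bad
    one. *)
Lemma branch_sumE T B : exploration s h0 psi T B ->
  branch_sum T B = ([forall e, (e \notin T) && (e \notin B) ==> good e])%:R%R.
Proof.
have [n] := ubnP #|~: (T :|: B)|; elim: n T B => // n IH T B lt expl.
have ltU e : e \notin T -> e \notin B ->
    #|~: (e |: T :|: B)| < n /\ #|~: (T :|: (e |: B))| < n.
  move=> eT eB; rewrite [T :|: (e |: B)]setUCA setUA; suff: #|~: (e |: T :|: B)| < n by [].
  rewrite (cardsD1 e) in_setC in_setU negb_or eT eB ltnS in lt.
  suff -> : ~: (e |: T :|: B) = ~: (T :|: B) :\ e by [].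
  by apply/setP => g; rewrite !inE !negb_or andbA.
have [/existsP[u /and3P[ub uT uB]]|] :=
    boolP [exists u : H, [&& u \in blob T, u.1 \notin T & u.1 \notin B]].
  case: (@arg_minnP _ u (fun u => [&& u \in blob T, u.1 \notin T & u.1 \notin B])
    (fun u => idx T u)) => [|h /and3P[hb hT hB] hmin0]; first by rewrite ub uT uB.
  have hmin z : z.1 \notin T -> z.1 \notin B -> idx T h <= idx T z.
    move=> zT zB; have [zb|zb] := boolP (z \in blob T).
      by apply: hmin0; rewrite zb zT zB.
    by rewrite (findex_notin zb) ltnW // findex_in.
  have [lt1 lt2] := ltU _ hT hB; have cB := expl_conn expl.
  have blackB g : g \in B -> idx T (g, false) < idx T h.
    by move=> gB; apply: (expl_black expl gB).2.
  have whiteE : h.2 -> (h.1, true) = h /\ (h.1, false) = flip h by case: (h) => e [].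
  have blackE : ~~ h.2 -> (h.1, false) = h /\ (h.1, true) = flip h by case: (h) => e [].
  have [fh|fh] := boolP (flip h \in blob T).
    (* A loop is in no Jaeger tree. If [h] is white, no tree is left and the edge is bad; if [h] is
       black, the edge is good and is deleted. *)
    have delE := branch_sum_deleted hT hB (fun T' jT' sub TB => jaeger_loop hT hB hb jT' sub fh).
    have [h2|h2] := boolP h.2.
      rewrite /branch_sum big_pred0 => [|T'].
        rewrite (forall_undecided hT hB); suff /negbTE -> : ~~ good h.1 by [].
        by rewrite -leqNgt (whiteE h2).1 (whiteE h2).2 (loop_psi expl hT hB hb hmin fh).
      apply/negP => /and3P[jT' sub TB]; move/negP: (jaeger_loop hT hB hb jT' sub fh); apply.
      exact: jaeger_white jT' sub TB.
    rewrite delE IH //; last by apply: (exploration_delete expl) => //; apply: (loop_connected expl).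
    rewrite (forall_undecided hT hB) forall_undecidedC.
    suff -> : good h.1 by [].
    rewrite /good_edge ltn_neqAle psi_neq /= (blackE h2).1 (blackE h2).2.
    exact: (loop_psi expl hT hB hb hmin fh).
  (* The right side does not mention [T'], so the weight of [h.1] can be taken out of the sum. *)
  have wE T' (jT' : jaeger T') (sub : T \subset T') (TB : [disjoint T' & B]) (hT' : h.1 \in T') :
      flippable T' h.1 = ~~ h.2 && connected_off s (h.1 |: B).
    apply/idP/andP => [fl|[h2 c]]; last exact: (connected_flippable hT hB hb hmin jT' sub TB).
    have h2 : ~~ h.2.
      apply/negP => h2; case/existsP: fl => g /and3P[_ /andP[lt3 lt4] _].
      have := ltn_trans lt3 lt4; rewrite (whiteE h2).1 (whiteE h2).2 (prefix_idx_h hb hmin sub TB) ltnNge ltnW //.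
      by apply: (prefix_undecided hb hmin) => //; rewrite flip_neq.
    by split=> //; apply: (flippable_connected hT hB hb hmin jT' sub TB hT' blackB fl).
  have sum0 : (forall T', jaeger T' -> T \subset T' -> [disjoint T' & B] -> h.1 \in T') ->
      branch_sum T (h.1 |: B) = 0%R.
    move=> hyp; rewrite /branch_sum big_pred0 // => T'; apply/negP => /and3P[jT' sub].
    rewrite -setI_eq0 setIUr setU_eq0 !setI_eq0 disjoint_sym disjoints1 => /andP[/negP hT' TB].
    by apply: hT'; apply: hyp.
  have contractE : psi h < psi (flip h) \/ ~~ connected_off s (h.1 |: B) ->
      branch_sum (h.1 |: T) B = ([forall e, (e \notin h.1 |: T) && (e \notin B) ==> good e])%:R%R.
    by move=> hyp; apply: IH => //; apply: exploration_contract hyp.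
  rewrite (branch_sum_split T hB) (forall_undecided hT hB) natr_and.
  have [h2|h2] := boolP h.2.
    rewrite sum0 ?add0r; last first.
      by move=> T' jT' sub TB; apply: (jaeger_white hT hB hb hmin h2 jT' sub TB).
    rewrite (@branch_sum_included T B h.1 (good h.1)%:R%R) //; last first.
      by move=> T' jT' sub TB hT'; rewrite /tree_weight wE // h2.
    have [g|_] := boolP (good h.1); last by rewrite !mul0r.
    rewrite contractE //; left.
    by move: g; rewrite /good_edge (whiteE h2).1 (whiteE h2).2.
  have [c|c] := boolP (connected_off s (h.1 |: B)).
    rewrite (@branch_sum_included T B h.1 (- (~~ good h.1)%:R)%R) //; last first.
      by move=> T' jT' sub TB hT'; rewrite /tree_weight wE // h2 c.
    rewrite IH //; last exact: exploration_delete.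
    rewrite forall_undecidedC; have [g|ng] := boolP (good h.1).
      by rewrite oppr0 mul0r addr0 mul1r.
    (* A bad edge met at its black end leads upwards, so contraction preserves the invariant; both
       branches then have the same indicator, with opposite signs. *)
    rewrite contractE ?forall_undecidedC ?mulN1r ?subrr ?mul0r //; left.
    move: ng; rewrite /good_edge -leqNgt leq_eqVlt eq_sym (negbTE (psi_neq _)) /=.
    by rewrite (blackE h2).1 (blackE h2).2.
  rewrite sum0 ?add0r; last first.
    move=> T' jT' sub TB; apply: contraNT c => hT'; apply: (jaeger_connected jT').
    by rewrite -setI_eq0 setIUr setU_eq0 !setI_eq0 disjoint_sym disjoints1 hT'.
  rewrite (@branch_sum_included T B h.1 (good h.1)%:R%R) //; last first.
    by move=> T' jT' sub TB hT'; rewrite /tree_weight wE // (negbTE c) andbF.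
  by rewrite contractE //; right.
rewrite negb_exists => /forallP dec.
have [fT TB bT blB /connected_offP cB _] := expl.
(* With nothing undecided on the blob, it is stable and hence everything; [T] is the only tree
   left. *)
have full : blob T = [set: H].
  apply: (cB _ h0); first exact: porbit_id.
  apply/stableP; split=> z zb.
    have := forest_step z fT; rewrite porbit_sym.
    by move: zb; rewrite -!eq_porbit_mem => /eqP -> /eqP ->.
  move=> zB; have := dec z; rewrite zb zB andbT negbK /= => zT.
  have := forest_flip fT zT; rewrite porbit_sym.
  by move: zb; rewrite -!eq_porbit_mem => /eqP -> /eqP ->.
have decE e : (e \notin T) && (e \notin B) = false.
  by apply/negbTE; have := dec (e, true); rewrite full inE.
have jT : jaeger T.
  have fl : [forall h, h \in blob T] by apply/forallP => h; rewrite full inE.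
  apply/and3P; split => //; first by rewrite -(eqP fT) (full_porbits fl) addn1.
  apply/forall_inP => g gT; apply: (blB g _).1.
  by apply/negPn/negP => gB; have := decE g; rewrite gT gB.
rewrite (_ : [forall e, _]); last by apply/forallP => e; rewrite decE.
rewrite /branch_sum (big_pred1 T) ?setDv ?big_set0 // => T' /=.
apply/and3P/eqP => [[jT' sub TB']|->]; last by split.
apply/eqP; rewrite eqEsubset sub andbT; apply/subsetP => e eT'.
by apply/negPn/negP => eT; have := decE e; rewrite eT (disjointFr TB' eT').
Qed.

Lemma prodr_bool (P Q : pred E) :
  (\prod_(e | P e) (Q e)%:R = ([forall (e | P e), Q e])%:R :> R)%R.
Proof.
have [/forall_inP hyp|] := boolP [forall (e | P e), Q e].
  by rewrite big1 // => e /hyp ->.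
rewrite negb_forall => /existsP[e]; rewrite negb_imply => /andP[Pe /negbTE Qe].
by rewrite (bigD1 e) //= Qe mul0r.
Qed.

(* [T :\: V] runs over the forests obtained from [T] by removing some of the
   edges whose removal gives an interior face of the triangulation. *)
Lemma tree_expansion : connected_off s set0 ->
  (\sum_(T | jaeger T) \sum_(V : {set E} | (V \subset T) && [forall e in V, flippable T e])
     (-1) ^+ #|V| * ([forall e in T :\: V, good e])%:R = ([forall e, good e])%:R :> R)%R.
Proof.
move=> c0; have := branch_sumE (exploration0 h0 psi_s c0).
rewrite (_ : [forall e, (e \notin set0) && (e \notin set0) ==> good e] = [forall e, good e]);
  last by apply: eq_forallb => e; rewrite inE.
move=> <-; apply: eq_big => [T|T jT]; first by rewrite sub0set -setI_eq0 setI0 eqxx !andbT.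
(* Each flippable weight is written as [-1] plus the indicator; [bigA_distr] then makes [V] the set
   of edges at which [-1] is chosen. *)
rewrite setD0 big_mkcond [RHS]big_mkcond [RHS](eq_bigr (fun e =>
  (if (e \in T) && flippable T e then -1 else 0) + (if e \in T then (good e)%:R else 1))%R); last first.
  move=> e _; rewrite /tree_weight; case: (e \in T) => /=; last by rewrite add0r.
  by case: ifP => _; rewrite ?add0r //; case: (good e); rewrite /= ?mulr1n ?mulr0n ?oppr0 ?addNr ?addr0.
rewrite bigA_distr; apply: eq_bigr => V _; case: ifP => [/andP[sub /forall_inP fl]|nfl].
  rewrite -prodr_bool [RHS](bigID (mem V)) /=; congr (_ * _)%R.
    rewrite (eq_bigr (fun=> -1)%R) ?prodr_const // => e eV.
    by rewrite eV (subsetP sub) ?fl.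
  rewrite [RHS]big_mkcond [LHS]big_mkcond; apply: eq_bigr => e _; rewrite inE.
  by case: (e \in V); case: (e \in T).
apply/esym/eqP; move/negbT: nfl; rewrite negb_and => /orP[/subsetPn[e eV eT]|].
  by rewrite (bigD1 e) //= eV (negbTE eT) mul0r.
rewrite negb_forall => /existsP[e]; rewrite negb_imply => /andP[eV /negbTE fe].
by rewrite (bigD1 e) //= eV fe andbF mul0r.
Qed.
End Expansion.

(** Cycle counts of permutations, even of different types, are compared through the relation of
    lying on one cycle, without a bijection between the cycles. *)
Lemma card_imset_eqker (X U U' : finType) (F : {set X}) (f : X -> U) (g : X -> U') :
  {in F &, forall x y, (f x == f y) = (g x == g y)} -> #|f @: F| = #|g @: F|.
Proof.
suff le (W W' : finType) (u : X -> W) (v : X -> W') :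
    {in F &, forall x y, (u x == u y) = (v x == v y)} -> #|u @: F| <= #|v @: F|.
  move=> fg; apply/eqP; rewrite eqn_leq !le // => x y xF yF.
  by rewrite fg.
move=> uv; have [->|[x0 _]] := set_0Vmem F; first by rewrite imset0 cards0.
pose k w := u (odflt x0 [pick x in F | v x == w]).
suff -> : u @: F = k @: (v @: F) by apply: leq_imset_card.
have kv x : x \in F -> k (v x) = u x.
  rewrite /k => xF; case: pickP => [y /andP[yF /eqP vy]|/(_ x)]; last by rewrite xF eqxx.
  by apply/eqP; rewrite uv // vy.
rewrite -imset_comp; apply: eq_in_imset => x xF /=; by rewrite kv.
Qed.

(** * Induced permutations *)

Section PermSets.
Local Open Scope group_scope.
Variable X : finType.
Implicit Types (a b c k r : {perm X}) (D F : {set X}) (x y : X).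

(** The cycles counted meet [D] but need not be contained in it. *)
Definition cycles_in D a := #|porbit a @: D|.

Lemma porbitV a x : porbit a^-1 x = porbit a x.
Proof.
suff sub b : porbit b^-1 x \subset porbit b x.
  by apply/eqP; rewrite eqEsubset sub -{1}[a]invgK sub.
apply: sub_porbit => [y yx|]; last exact: porbit_id.
by rewrite -(porbit_step b) permKV.
Qed.

Lemma eq_porbit D a b x : (forall y, y \in D -> a y \in D) ->
  {in D, a =1 b} -> x \in D -> porbit a x = porbit b x.
Proof.
move=> aD ab xD; have bD y : y \in D -> b y \in D by move=> yD; rewrite -ab ?aD.
have sub (u v : {perm X}) : (forall y, y \in D -> u y \in D) ->
    {in D, u =1 v} -> porbit u x \subset porbit v x.
  move=> uD uv; apply: (@subset_trans _ _ (mem (D :&: porbit v x))); last exact: subsetIr.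
  apply: sub_porbit => [y|]; last by rewrite inE xD porbit_id.
  by rewrite !inE => /andP[yD yx]; rewrite uD // uv // porbit_step.
by apply/eqP; rewrite eqEsubset !sub // => y yD; rewrite ab.
Qed.

Lemma porbitsT a : porbits a = porbit a @: [set: X].
Proof. by apply/setP => w; apply/imsetP/imsetP => -[x _ ->]; exists x. Qed.

Lemma card_porbitsU D a : (forall y, y \in D -> a y \in D) ->
  #|porbits a| = cycles_in D a + cycles_in (~: D) a.
Proof.
move=> aD; rewrite /cycles_in -cardsUI.
have -> : (porbit a @: D) :&: (porbit a @: (~: D)) = set0.
  apply/eqP; rewrite setI_eq0; apply/pred0P => w /=; apply/negP.
  move=> /andP[/imsetP[x xD ->] /imsetP[y]]; rewrite inE => yD xy.
  move/negP: yD; apply; apply: (subsetP (sub_porbit aD xD)).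
  by rewrite xy porbit_id.
by rewrite cards0 addn0 -imsetU setUCr porbitsT.
Qed.

Lemma cycles_in_id D a : {in D, a =1 id} -> cycles_in D a = #|D|.
Proof.
move=> aD; rewrite /cycles_in card_in_imset // => x y xD yD xy.
have := porbit_id a y; rewrite -xy -(eq_porbit (D := D) (a := 1)) => [||z zD|].
- by move=> /porbitP[i]; rewrite expg1n perm1.
- by move=> z zD; rewrite perm1.
- by rewrite perm1 aD.
- by [].
Qed.

Lemma perm_on_stable D a : perm_on D a -> forall y, y \in D -> a y \in D.
Proof. by move=> aD y; rewrite perm_closed. Qed.

Lemma perm_on_porbits D a : perm_on D a -> #|porbits a| = cycles_in D a + #|~: D|.
Proof.
move=> aD; rewrite (card_porbitsU (perm_on_stable aD)); congr addn.
by apply: cycles_in_id => x; rewrite inE => /(out_perm aD).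
Qed.

Section Geodesic.
Variables (D : {set X}) (r c : {perm X}).
Hypotheses (rD : perm_on D r) (cD : forall y, y \in D -> c y \in D).

Let crE : #|porbits (c * r^-1)| + #|D| =
  cycles_in D (c * r^-1) + #|porbits c| + #|D| - cycles_in D c.
Proof.
have crD y : y \in D -> (c * r^-1) y \in D.
  by move=> yD; rewrite permM perm_closed ?perm_onV // cD.
rewrite (card_porbitsU crD) (card_porbitsU cD).
suff -> : cycles_in (~: D) (c * r^-1) = cycles_in (~: D) c by lia.
rewrite /cycles_in (@eq_in_imset _ _ _ (porbit c)) // => x xD.
have cC y : y \in ~: D -> c y \in ~: D.
  rewrite !inE; apply: contra => cy.
  by have := subsetP (sub_porbit cD cy) y; rewrite porbit_sym porbit_step porbit_id => /(_ isT).
apply/esym/(eq_porbit cC _ xD) => y /cC; rewrite inE permM => cy.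
by rewrite (out_perm (perm_onV rD)).
Qed.

Lemma cycles_in_mul : cycles_in D r + cycles_in D (c * r^-1) <= #|D| + cycles_in D c.
Proof.
have := porbits_mul_ge (c * r^-1) r; have := crE; rewrite mulgKV.
rewrite (perm_on_porbits rD) -(cardsC D) (card_porbitsU cD); lia.
Qed.

(** Outside [D], [c * r^-1] agrees with [c], so the equality on [D] is one on all of [X], and
    [porbits_mul_geodesic] applies to [c] as the product of [c * r^-1] and [r]. *)
Lemma geodesic_porbit x :
  cycles_in D r + cycles_in D (c * r^-1) = #|D| + cycles_in D c ->
  r x \in porbit c x.
Proof.
move=> geo; have E : #|porbits (c * r^-1)| + #|porbits r| = #|X| + #|porbits c|.
  by have := crE; rewrite (perm_on_porbits rD) -(cardsC D) (card_porbitsU cD); lia.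
have := porbits_mul_geodesic (a := c * r^-1) (b := r) ((c * r^-1)^-1 x).
rewrite permKV mulgKV => /(_ E); rewrite invMg invgK permM => xc.
rewrite -(permKV c (r x)) porbit_step; move: xc; rewrite -!eq_porbit_mem => /eqP ->.
by [].
Qed.
End Geodesic.

(* The permutation that [k] induces on [F] is trivial. *)
Definition reduced F k :=
  [forall x in F, forall y in F, (y \in porbit k x) ==> (y == x)].

Lemma reducedP F k : reflect
  {in F &, forall x y, y \in porbit k x -> y = x} (reduced F k).
Proof.
apply: (iffP forall_inP) => [h x y xF yF yx|h x xF].
  by have /forall_inP/(_ y yF) := h x xF; rewrite yx => /eqP.
by apply/forall_inP => y yF; apply/implyP => yx; rewrite (h x y).
Qed.

(** From [z] in [F], the walk under [r * k] follows the [k]-cycle of [r z], which meets [F] only at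
    [r z]. So the first return map on [F] is [r]. *)
Lemma first_return F k r : reduced F k -> perm_on F r ->
  {in F &, forall x y, (y \in porbit (r * k) x) = (y \in porbit r x)}.
Proof.
move=> /reducedP red rF x y xF yF; apply/idP/idP => [yx|].
  pose Z := [set z | [exists w in F, (w \in porbit r x) && (z \in porbit k w)]].
  have ZS z : z \in Z -> (r * k) z \in Z.
    rewrite !inE => /exists_inP[w wF /andP[wx zw]]; apply/exists_inP.
    have [zF|zF] := boolP (z \in F).
      exists (r z); first by rewrite perm_closed.
      by rewrite permM !porbit_step porbit_id andbT (red w z).
    by exists w => //; rewrite permM (out_perm rF zF) porbit_step wx.
  have xZ : x \in Z by rewrite inE; apply/exists_inP; exists x; rewrite ?porbit_id.
  have := subsetP (sub_porbit ZS xZ) y yx; rewrite inE => /exists_inP[w wF /andP[wx yw]].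
  by rewrite (red w y).
have step z : z \in F -> r z \in porbit (r * k) z.
  move=> zF; have rzF : r z \in F by rewrite perm_closed.
  have it i : i < fingraph.order k (r z) -> iter i.+1 (r * k) z = iter i.+1 k (r z).
    elim: i => [|i IH] lt; first by rewrite /= permM.
    rewrite iterS IH ?(ltn_trans _ lt) // permM (out_perm rF) //.
    apply/negP => iF; have : iter i.+1 k (r z) = r z.
      by apply: red => //; rewrite porbit_fconnect fconnect_iter.
    by move=> /(congr1 (findex k (r z))); rewrite findex_iter // findex0.
  have := it (fingraph.order k (r z)).-1; rewrite orderSpred => /(_ (leqnn _)).
  rewrite iter_order; last exact: perm_inj.
  by move=> <-; rewrite porbit_fconnect fconnect_iter.
have ZF z : z \in F :&: porbit (r * k) x -> r z \in F :&: porbit (r * k) x.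
  rewrite !inE => /andP[zF zx]; rewrite perm_closed // zF.
  by have := step z zF; move: zx; rewrite -!eq_porbit_mem => /eqP ->.
have xZ : x \in F :&: porbit (r * k) x by rewrite inE xF porbit_id.
by move=> yx; have := subsetP (sub_porbit ZF xZ) y yx; rewrite inE => /andP[].
Qed.

Lemma reducedV F k : reduced F k^-1 = reduced F k.
Proof. by apply: eq_forallb_in => x _; apply: eq_forallb => y; rewrite porbitV. Qed.

Lemma first_returnV F k r : reduced F k -> perm_on F r ->
  {in F &, forall x y, (y \in porbit (k * r) x) = (y \in porbit r x)}.
Proof.
move=> red rF x y xF yF; rewrite -porbitV invMg -[porbit r x]porbitV.
by apply: first_return xF yF; rewrite ?reducedV ?perm_onV.
Qed.

(** For [r] maximizing the number of cycles, two points of [F] on one cycle could still be separated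
    by their transposition. *)
Lemma reduced_exists F a : exists2 r, perm_on F r & reduced F (r^-1 * a).
Proof.
case: (@arg_maxnP _ 1%g (perm_on F) (fun r => #|porbits (r^-1 * a)|)) => [|r rF rmax].
  exact: perm_on1.
exists r => //; apply/reducedP => x y xF yF yx; apply/eqP/negPn/negP => xy.
have tF : perm_on F (tperm y x).
  by apply: (subset_trans (tperm_on y x)); rewrite subUset !sub1set xF yF.
have := rmax _ (perm_onM rF tF).
by rewrite invMg tpermV -mulgA porbits_tperm_split //= ltnn.
Qed.

(** The first return map of [k'], which is [r'^-1 * r * k], is [r'^-1 * r] on [F]; since [k'] is
    reduced, it is trivial. *)
Lemma reduced_unique F k k' r r' : reduced F k -> reduced F k' ->
  perm_on F r -> perm_on F r' -> r * k = r' * k' -> r = r'.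
Proof.
move=> red red' rF rF' E; have rrF := perm_onM (perm_onV rF') rF.
have Ek : k' = r'^-1 * r * k by rewrite -mulgA E mulKg.
have rr1 : r'^-1 * r = 1.
  apply/permP => x; rewrite perm1; have [xF|xF] := boolP (x \in F); last by rewrite (out_perm rrF).
  have := first_return red rrF xF; rewrite -Ek => /(_ ((r'^-1 * r) x)).
  rewrite perm_closed // porbit_step porbit_id => /(_ xF).
  by move/reducedP: red' => red' /red' -> //; rewrite perm_closed.
by rewrite -[r]mul1g -(mulgV r') -mulgA rr1 mulg1.
Qed.
End PermSets.

Lemma findex_conj (T : finType) (p q f : {perm T}) x y :
  (forall z, q (f z) = f (p z)) -> findex q (f x) (f y) = findex p x y.
Proof.
move=> qf; have it i z : iter i q (f z) = f (iter i p z).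
  by elim: i => //= i ->; rewrite qf.
have oE : fingraph.order q (f x) = fingraph.order p x.
  have oP (r : {perm T}) z : fingraph.order r z = #|porbit r z|.
    by apply: eq_card => w; rewrite porbit_fconnect.
  rewrite !oP -(card_imset (porbit p x) (@perm_inj _ f)); apply: eq_card => w.
  apply/porbitP/imsetP => [[i ->]|[z /porbitP[i ->] ->]].
    by exists ((p ^+ i)%g x); rewrite ?mem_porbit // !permX it.
  by exists i; rewrite !permX it.
rewrite /findex /fingraph.orbit oE.
have -> : traject q (f x) (fingraph.order p x) = map f (traject p x (fingraph.order p x)).
  move: (fingraph.order p x) => n; elim: n {oE} (x) => //= n IH z.
  by rewrite qf IH.
by rewrite index_map //; apply: perm_inj.
Qed.

(** * Classes of factorizations *)

Section Maps.
Local Open Scope group_scope.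
Variable E : finType.
Local Notation H := (E * bool)%type.
Implicit Types (t tb r k c : {perm E}) (T V F : {set E}) (e g : E) (h z : H).

Definition turn t tb h : H := ((if h.2 then t h.1 else tb h.1), h.2).

Lemma turn_inj t tb : injective (turn t tb).
Proof. by move=> [e b] [e' b'] [+ bb] /=; rewrite bb; case: b' {bb} => /perm_inj ->. Qed.

Definition vperm t tb : {perm H} := perm (@turn_inj t tb).

Lemma vpermE t tb h : vperm t tb h = ((if h.2 then t h.1 else tb h.1), h.2).
Proof. by rewrite permE. Qed.

Lemma porbit_vperm t tb e b h :
  (h \in porbit (vperm t tb) (e, b)) = (h.2 == b) && (h.1 \in porbit (if b then t else tb) e).
Proof.
have vX i : (vperm t tb ^+ i) (e, b) = (((if b then t else tb) ^+ i) e, b).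
  elim: i => [|i IH]; first by rewrite !perm1.
  by rewrite !expgSr !permM IH vpermE /=; case: b {IH}.
apply/porbitP/andP => [[i ->]|[/eqP hb /porbitP[i hi]]].
  by rewrite vX eqxx mem_porbit.
by exists i; rewrite vX -hi -hb -surjective_pairing.
Qed.

Lemma card_porbits_vperm t tb : #|porbits (vperm t tb)| = #|porbits t| + #|porbits tb|.
Proof.
pose f b (w : {set E}) := [set h : H | (h.2 == b) && (h.1 \in w)].
have fE b e : porbit (vperm t tb) (e, b) = f b (porbit (if b then t else tb) e).
  by apply/setP => h; rewrite porbit_vperm inE.
have f_inj b : injective (f b).
  by move=> w w' /setP ww; apply/setP => e; have := ww (e, b); rewrite !inE eqxx.
have -> : porbits (vperm t tb) = (f true @: porbits t) :|: (f false @: porbits tb).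
  apply/setP => w; rewrite in_setU; apply/imsetP/orP => [[[e b] _ ->]|[]].
  - by rewrite fE; case: b; [left|right]; apply/imset_f/imset_f.
  - by case/imsetP => _ /imsetP[e _ ->] ->; exists (e, true); rewrite ?fE.
  - by case/imsetP => _ /imsetP[e _ ->] ->; exists (e, false); rewrite ?fE.
have I0 : (f true @: porbits t) :&: (f false @: porbits tb) = set0.
  apply/setP => w; rewrite !inE; apply/negbTE/negP => /andP[/imsetP[u /imsetP[e _ ->] ->]].
  by case/imsetP => u' _ /setP/(_ (e, true)); rewrite !inE /= porbit_id.
by rewrite cardsU I0 cards0 subn0 (card_imset (porbits t)) // (card_imset (porbits tb)).
Qed.

Section Rooted.
Variable x0 : E.
Let h0 : H := (x0, true).

(* [T] is a spanning tree of the map [(t, tb)] corresponding to a maximal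
   simplex, and [V] a set of edges of [T] such that the simplex of [T :\: V]
   is an interior face that is counted with [T]. *)
Definition marked_core t tb T V :=
  let s := vperm t tb in
  [&& [forall h, h \in porbit (tour s T) h0],
     [forall (g | g \notin T), findex (tour s T) h0 (g, false) < findex (tour s T) h0 (g, true)],
     V \subset T & [forall e in V, flippable s h0 T e]].

(** The vertex count is kept apart from the core because twisting preserves the core but may change
    the number of vertices. *)
Definition marked t tb T V :=
  marked_core t tb T V && (#|T|.+1 == #|porbits t| + #|porbits tb|).

Lemma markedE t tb T V : marked t tb T V =
  [&& jaeger (vperm t tb) h0 T, V \subset T & [forall e in V, flippable (vperm t tb) h0 T e]].
Proof.
rewrite /marked /marked_core /jaeger card_porbits_vperm -!andbA.
by do !bool_congr; rewrite andbC -!andbA.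
Qed.

(** Suppose all tree edges at a vertex lie in [V]. The tour enters it along such an edge from the
    black end, so the vertex is white, and stays there until it returns. But an interlacing edge has
    its black end met in this interval. *)
Lemma marked_cover t tb T V h : marked_core t tb T V ->
  exists2 z, z \in porbit (vperm t tb) h & z.1 \in T :\: V.
Proof.
set s := vperm t tb; case/and4P => /forallP full /forall_inP black sub /forall_inP flip_V.
apply/exists_inP; apply: contraT; rewrite negb_exists_in => /forall_inP nF.
pose Q := porbit s h; pose idx z := findex (tour s T) h0 z.
have nQ z : z \in Q -> z.1 \notin T :\: V by apply: nF.
have idx_step z : idx (tour s T z) = (idx z).+1 \/ tour s T z = h0.
  have zc : fconnect (tour s T) h0 z by rewrite -porbit_fconnect.
  have [lt|le] := ltnP (idx z).+1 (fingraph.order (tour s T) h0).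
    left; rewrite -{1}(iter_findex zc) -iterS; exact: findex_iter.
  right; have E1 : (idx z).+1 = fingraph.order (tour s T) h0.
    by apply/eqP; rewrite eqn_leq le andbT; apply: findex_max.
  by rewrite -{1}(iter_findex zc) -iterS -/(idx z) E1 iter_order //; apply: perm_inj.
have idx_inj z w : idx z = idx w -> z = w by apply: findex_inj.
have Vlt e : e \in V -> exists g, [/\ idx (e, false) < idx (g, false),
    idx (g, false) < idx (e, true) & idx (e, true) < idx (g, true)].
  by move=> /flip_V/existsP[g /and3P[_ /andP[? ?] ?]]; exists g.
have Vblack e : e \in V -> idx (e, false) < idx (e, true).
  by move=> /Vlt[g [lt1 lt2 _]]; apply: ltn_trans lt2.
have sQ z : (s z \in Q) = (z \in Q) by rewrite porbit_step.
case: (@arg_minnP _ h (fun z => z \in Q) idx) => [|z zQ zmin]; first exact: porbit_id.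
(* Edges in [V] or outside [T] are met at the black end first, while the root is a white end of
   index 0. *)
have z0 : z != h0.
  apply: contraL (nQ _ zQ) => /eqP ->; rewrite negbK inE.
  have idx0 : idx h0 = 0 by apply: findex0.
  apply/andP; split; first by apply/negP => /Vblack; rewrite -/h0 idx0.
  by apply/negPn/negP => /black; rewrite -/h0 -/(idx h0) idx0.
have [w wz] : exists w, tour s T w = z by exists ((tour s T)^-1 z); rewrite permKV.
have idx_w : idx z = (idx w).+1.
  by case: (idx_step w); rewrite wz // => zh; rewrite zh eqxx in z0.
have wQ : w \notin Q by apply/negP => /zmin; rewrite idx_w ltnn.
have wT : w.1 \in T.
  by apply: contraNT wQ => wT; move: zQ; rewrite -wz tourE (negbTE wT) sQ.
have fwQ : flip w \in Q by move: zQ; rewrite -{1}wz tourE wT sQ.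
have wV : w.1 \in V by move: (nQ _ fwQ); rewrite inE /= wT andbT negbK.
have fw2 : w = (w.1, false).
  case: (w) fwQ wV idx_w => e [] //= fwQ /Vblack lt idx_w; exfalso.
  by have := zmin _ fwQ; rewrite idx_w /flip /= leqNgt ltnS ltnW.
have fwE : flip w = (w.1, true) by rewrite /flip {2}fw2.
have QE : Q = porbit s (flip w) by apply/eqP; rewrite eq_sym eq_porbit_mem.
have Qwhite y : y \in Q -> y.2 by rewrite QE fwE porbit_vperm => /andP[/eqP].
(* To leave the vertex at [u], the tour would cross an edge of [V] whose black end was met between
   [w] and [u]; by induction this end is in [Q], which is white. *)
have inQ n y : idx y < n -> idx w < idx y -> idx y <= idx (flip w) -> y \in Q.
  elim: n y => // n IH y; rewrite ltnS => le_n lt_y le.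
  have [u uy] : exists u, tour s T u = y by exists ((tour s T)^-1 y); rewrite permKV.
  have idx_u : idx y = (idx u).+1.
    by case: (idx_step u); rewrite uy // => yh; move: lt_y; rewrite yh /idx findex0.
  rewrite idx_u in le_n lt_y le.
  move: lt_y; rewrite ltnS leq_eqVlt => /orP[/eqP/idx_inj wu|lt_u].
    by rewrite -uy -wu wz.
  have uQ : u \in Q by apply: IH => //; apply: ltnW.
  rewrite -uy tourE; case: ifP => uT; last by rewrite sQ.
  have uV : u.1 \in V by move: (nQ _ uQ); rewrite inE uT andbT negbK.
  have u2 : u = (u.1, true) by rewrite -(Qwhite _ uQ) -surjective_pairing.
  pose v := (u.1, false); have := Vblack _ uV; rewrite -/v -u2 => lt_vu.
  have tv : tour s T v = s u by rewrite tourE uT /flip /= -u2.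
  case: (idx_step v) => [idx_v|vh]; last first.
    have /zmin : tour s T v \in Q by rewrite tv sQ.
    by rewrite vh idx_w /idx findex0.
  have /zmin : tour s T v \in Q by rewrite tv sQ.
  rewrite idx_w idx_v ltnS leq_eqVlt => /orP[/eqP/idx_inj wv|lt_wv].
    have uw : u = flip w by rewrite wv u2.
    by exfalso; move: le; rewrite uw ltnn.
  have vQ : v \in Q.
    by apply: IH => //; [apply: ltn_trans lt_vu _ | apply/ltnW/(ltn_trans lt_vu)].
  by have := Qwhite _ vQ.
have [g [lt1 lt2 _]] := Vlt _ wV; rewrite -fw2 -fwE in lt1 lt2.
have : (g, false) \in Q.
  by apply: (inQ _ _ (leqnn _)) => //; apply: ltnW.
by move/Qwhite.
Qed.
End Rooted.
End Maps.

Section Twist.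
Local Open Scope group_scope.
Variables (E : finType) (x0 : E).
Local Notation H := (E * bool)%type.
Let h0 : H := (x0, true).
Implicit Types (t tb r k c : {perm E}) (T V F : {set E}) (e g : E) (h z : H).

(* Replacing [(t, tb)] by [(r * t, tb * r^-1)] with [r] supported by [F]
   conjugates the tour by a permutation that only moves the black ends of [F]. *)
Lemma tour_twist t tb r F T h : perm_on F r -> F \subset T ->
  tour (vperm (r * t) (tb * r^-1)) T (vperm 1 r^-1 h) =
  vperm 1 r^-1 (tour (vperm t tb) T h).
Proof.
move=> rF sub; case: h => e b; rewrite !tourE !vpermE /=.
have rT x : x \notin T -> r x = x.
  by move=> xT; apply: (out_perm rF); apply: contra xT; apply: (subsetP sub).
have rVT x : (r^-1 x \in T) = (x \in T) by rewrite (perm_closed _ (subset_trans (perm_onV rF) sub)).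
case: b; case eT: (e \in T); rewrite /= ?perm1 ?rVT ?eT /= ?perm1 ?permM ?permKV //.
  by rewrite rT ?eT.
by rewrite -{1}(rT e) ?eT // permK.
Qed.

(** The core compares only positions of half-edges of [V] and outside [T]. The conjugation moves
    none of these, nor the root, which is white. *)
Lemma marked_core_twist t tb T V r : perm_on (T :\: V) r ->
  marked_core x0 (r * t) (tb * r^-1) T V = marked_core x0 t tb T V.
Proof.
suff imp u ub q : perm_on (T :\: V) q -> marked_core x0 u ub T V ->
    marked_core x0 (q * u) (ub * q^-1) T V.
  move=> rF; apply/idP/idP; last exact: imp.
  by move/(imp _ _ _ (perm_onV rF)); rewrite invgK mulKg mulgKV.
move=> qF; have conj := tour_twist u ub _ qF (subsetDl T V).
have h0E : vperm 1 q^-1 h0 = h0 by rewrite vpermE /= perm1.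
have idxE e b : e \notin T :\: V ->
    findex (tour (vperm (q * u) (ub * q^-1)) T) h0 (e, b) =
    findex (tour (vperm u ub) T) h0 (e, b).
  move=> eF; have eE : vperm 1 q^-1 (e, b) = (e, b).
    by rewrite vpermE /= perm1; case: b; rewrite // (out_perm (perm_onV qF)).
  by rewrite -{1}h0E -{1}eE; apply: findex_conj => z; apply: conj.
case/and4P => /forallP full /forall_inP black sub /forall_inP fl.
have idxT e b : e \notin T ->
    findex (tour (vperm (q * u) (ub * q^-1)) T) h0 (e, b) =
    findex (tour (vperm u ub) T) h0 (e, b).
  by move=> eT; apply: idxE; rewrite inE negb_and eT orbT.
apply/and4P; split=> //.
- apply/forallP => h; rewrite -[h](permKV (vperm 1 q^-1)).
  have /porbitP[i ->] := full ((vperm 1 q^-1)^-1 h).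
  apply/porbitP; exists i; rewrite !permX; apply/esym.
  by elim: i => [|i IH]; [exact: esym h0E | rewrite !iterS IH conj].
- by apply/forall_inP => g gT; rewrite !idxT // black.
- apply/forall_inP => e eV; have eF : e \notin T :\: V by rewrite inE eV.
  have /existsP[g /andP[gT lt]] := fl e eV.
  have gF : g \notin T :\: V by rewrite inE negb_and gT orbT.
  by apply/existsP; exists g; rewrite gT !idxE.
Qed.

Lemma cover_cycles t tb T V : marked_core x0 t tb T V ->
  #|porbits t| = cycles_in (T :\: V) t /\ #|porbits tb| = cycles_in (T :\: V) tb.
Proof.
move=> core; suff cov b : porbits (if b then t else tb) = porbit (if b then t else tb) @: (T :\: V).
  by rewrite /cycles_in -(cov true) -(cov false).
apply/setP => w; apply/imsetP/imsetP => [[e _ ->]|[e _ ->]]; last by exists e.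
have [[z b'] + zF] := marked_cover (e, b) core.
rewrite porbit_vperm => /andP[/eqP /= bb ze]; exists z => //.
by apply/eqP; rewrite eq_porbit_mem porbit_sym.
Qed.

(** The vertices number at most [#|F| + cycles_in F c], by [cycles_in_mul], and this is at most
    [#|T|.+1] because the tour is a single cycle. A tree needs both equalities: one concerns the
    class, the other [r]. *)
Lemma marked_class k1 k2 c T V r (F := T :\: V) :
  reduced F k1 -> reduced F k2 -> perm_on F c -> perm_on F r ->
  marked x0 (r * k1) (k2 * (c * r^-1)) T V =
  marked x0 k1 (k2 * c) T V &&
    (cycles_in F r + cycles_in F (c * r^-1) == #|F| + cycles_in F c).
Proof.
move=> red1 red2 cF rF; rewrite /marked mulgA marked_core_twist //.
have [core|//] := boolP (marked_core x0 k1 (k2 * c) T V).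
have core' : marked_core x0 (r * k1) (k2 * c * r^-1) T V by rewrite marked_core_twist.
have [-> ->] := cover_cycles core; have [-> ->] := cover_cycles core'.
have ker1 q : perm_on F q -> cycles_in F (q * k1) = cycles_in F q.
  move=> qF; apply: card_imset_eqker => x y xF yF.
  by rewrite !eq_porbit_mem (first_return red1 qF).
have ker2 q : perm_on F q -> cycles_in F (k2 * q) = cycles_in F q.
  move=> qF; apply: card_imset_eqker => x y xF yF.
  by rewrite !eq_porbit_mem (first_returnV red2 qF).
rewrite -/F -mulgA ker1 // !ker2 ?perm_onM ?perm_onV //.
have kF : cycles_in F k1 = #|F|.
  by rewrite -[k1]mul1g ker1 ?perm_on1 // cycles_in_id // => x _; rewrite perm1.
have le1 := cycles_in_mul rF (perm_on_stable cF).
have le2 : #|F| + cycles_in F c <= #|T|.+1.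
  have /and4P[full _ _ _] := core.
  have := leq_tourU (vperm k1 (k2 * c)) (sub0set T).
  have [E1 E2] := cover_cycles core.
  by rewrite tour0 (full_porbits full) setD0 add1n card_porbits_vperm E1 E2 ker2 // kF.
rewrite kF /=; move: le1 le2; move: (cycles_in F r + _) (#|F| + _) #|T|.+1 => a b n ab bn.
apply/eqP/andP => [na|[/eqP -> /eqP -> //]].
have nb : n = b by apply/eqP; rewrite eqn_leq bn na ab.
by rewrite -na nb; split.
Qed.

Lemma trans_connected t tb :
  [transitive <<[set t; tb]>>, on [set: E] | 'P] -> connected_off (vperm t tb) set0.
Proof.
move=> tr; apply/connected_offP => X [e b] hX sX.
have fX z : (flip z \in X) = (z \in X) by rewrite (stable_flip sX) ?inE.
have /stableP[sX1 _] := sX.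
have tX u x : u \in [set t; tb] -> (x, true) \in X -> (u x, true) \in X.
  rewrite !inE => /orP[] /eqP -> xX; first by have := sX1 _ xX; rewrite vpermE.
  rewrite -[(tb x, true)]flipK fX; have : (x, false) \in X by rewrite -fX.
  by move=> /sX1; rewrite vpermE.
pose Y := [set x | (x, true) \in X].
have GY : <<[set t; tb]>> \subset 'N(Y | 'P).
  rewrite gen_subG; apply/subsetP => u uS; apply/astabsP => x; rewrite inE /= apermE.
  have uY y : y \in Y -> u y \in Y by rewrite !inE; apply: tX.
  rewrite [RHS]inE; apply/idP/idP => xX; last by apply: (tX u).
  have uYE : u @: Y = Y.
    apply/eqP; rewrite eqEcard card_imset ?leqnn ?andbT //; last exact: perm_inj.
    by apply/subsetP => y /imsetP[z zY ->]; apply: uY.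
  have : u x \in u @: Y by rewrite uYE inE.
  by case/imsetP => y + /perm_inj ->; rewrite inE.
have eY : e \in Y by rewrite inE; case: (b) hX => // hX; rewrite -fX.
have all x : x \in Y.
  have : x \in orbit 'P <<[set t; tb]>> e by rewrite (atransP tr) ?inE.
  by case/orbitP => u /(subsetP GY) /astabsP/(_ e) uE <-; rewrite uE.
apply/setP => -[x b']; rewrite inE; have := all x; rewrite inE.
by case: b' => // xX; rewrite -fX.
Qed.

Lemma marked_trans t tb T V : marked x0 t tb T V ->
  [transitive <<[set t; tb]>>, on [set: E] | 'P].
Proof.
rewrite markedE => /and3P[jT _ _].
have /connected_offP conn : connected_off (vperm t tb) set0.
  by apply: (jaeger_connected jT); rewrite -setI_eq0 setI0.
set G := <<_>>; pose O := orbit 'P G x0.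
have OS u x : u \in [set t; tb] -> x \in O -> u x \in O.
  move=> uS /orbitP[g gG <-]; apply/orbitP; exists (g * u); last by rewrite /= !apermE permM.
  by rewrite groupM // mem_gen.
have XT : [set h : H | h.1 \in O] = [set: H].
  apply: (conn _ h0); first by rewrite inE orbit_refl.
  apply/stableP; split=> [h|h]; rewrite !inE //= vpermE /=.
  by case: (h.2); apply: OS; rewrite !inE eqxx ?orbT.
apply/imsetP; exists x0; rewrite ?inE //; apply/setP => x.
by have /setP/(_ (x, true)) := XT; rewrite !inE.
Qed.
End Twist.

(** * Sums over colourings *)

Section Colourings.
Local Open Scope ring_scope.
Variables (A : comNzRingType) (L : nat).
Local Notation K := 'I_L.+1.

(* Colourings of [S], extended by a default value outside [S]. *)
Definition colours (W : finType) (S : {set W}) (chi : {ffun W -> K}) :=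
  [forall w, (w \notin S) ==> (chi w == ord0)].

Definition recolour (W W' : finType) (S : {set W'}) (f : W' -> W)
  (chi : {ffun W -> K}) : {ffun W' -> K} :=
  [ffun w => if w \in S then chi (f w) else ord0].

Lemma recolour_colours (W W' : finType) (S : {set W'}) (f : W' -> W) chi :
  colours S (recolour S f chi).
Proof. by apply/forallP => w; apply/implyP => /negbTE wS; rewrite ffunE wS. Qed.

Lemma coloursP (W : finType) (S : {set W}) (chi : {ffun W -> K}) w :
  colours S chi -> w \notin S -> chi w = ord0.
Proof. by move=> /forallP/(_ w)/implyP h /h /eqP. Qed.

Lemma sum_recolour (W W' : finType) (S : {set W}) (S' : {set W'})
    (f : W' -> W) (g : W -> W') (F : {ffun W' -> K} -> A) :
  {in S, forall w, g w \in S' /\ f (g w) = w} ->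
  {in S', forall w, f w \in S /\ g (f w) = w} ->
  \sum_(chi | colours S' chi) F chi = \sum_(chi | colours S chi) F (recolour S' f chi).
Proof.
move=> gS fS; rewrite (reindex_onto (recolour S' f) (recolour S g)); last first.
  move=> chi cS; apply/ffunP => w; rewrite ffunE; case: ifP => [wS|/negbT wS].
    by rewrite ffunE (fS w wS).1 (fS w wS).2.
  by rewrite (coloursP cS).
apply: eq_bigl => chi; rewrite recolour_colours /=; apply/eqP/idP => [<-|cS].
  exact: recolour_colours.
apply/ffunP => w; rewrite ffunE; case: ifP => [wS|/negbT wS].
  by rewrite ffunE (gS w wS).1 (gS w wS).2.
by rewrite (coloursP cS).
Qed.

Lemma sum_coloursU (W : finType) (S1 S2 : {set W}) (F1 F2 : {ffun W -> K} -> A) :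
  [disjoint S1 & S2] ->
  (forall chi chi' : {ffun W -> K}, {in S1, chi =1 chi'} -> F1 chi = F1 chi') ->
  (forall chi chi' : {ffun W -> K}, {in S2, chi =1 chi'} -> F2 chi = F2 chi') ->
  \sum_(chi | colours (S1 :|: S2) chi) F1 chi * F2 chi =
  (\sum_(chi | colours S1 chi) F1 chi) * (\sum_(chi | colours S2 chi) F2 chi).
Proof.
move=> dis F1E F2E; rewrite big_distrlr pair_big /=.
rewrite (reindex_onto (fun chi => (recolour S1 id chi, recolour S2 id chi))
  (fun p => [ffun w => if w \in S1 then p.1 w else p.2 w])) => [|[c1 c2] /andP[/= cS1 cS2]].
  apply: eq_big => [chi|chi _].
    rewrite !recolour_colours /=; apply/idP/eqP => [cS|<-].
      apply/ffunP => w; rewrite !ffunE; have [//|wS1] := boolP (w \in S1).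
      by have [//|wS2] := boolP (w \in S2); rewrite (coloursP cS) // inE negb_or wS1.
    apply/forallP => w; rewrite !ffunE inE negb_or; apply/implyP => /andP[/negbTE -> /negbTE ->].
    by [].
  by congr (_ * _); [apply: F1E | apply: F2E] => w wS; rewrite ffunE wS.
congr (_, _); apply/ffunP => w; rewrite !ffunE.
  by have [//|wS] := boolP (w \in S1); rewrite (coloursP cS1).
have [wS|wS] := boolP (w \in S2); last by rewrite (coloursP cS2).
by rewrite (disjointFl dis wS).
Qed.

Variables P Q : K -> A.

Definition ends (X : finType) (E : {set X}) : {set X * bool} := [set h | h.1 \in E].

(* N of the bipartite graph with edge set [E] whose half-edges [h] are attached
   to the vertices [v h]; the white vertices are those with [kap w = true]. *)
Definition graph_sum (X W : finType) (E : {set X}) (v : X * bool -> W) (kap : W -> bool) : A :=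
  \sum_(chi | colours (v @: ends E) chi)
    (\prod_(w in v @: ends E) (if kap w then P (chi w) else Q (chi w))) *
    ([forall x in E, (chi (v (x, true)) <= chi (v (x, false)))%N])%:R.

(** The sum sees the vertices only through their colours and through which half-edges share one. *)
Lemma graph_sum_transfer (X X' W W' : finType) (E : {set X}) (v : X * bool -> W)
    (v' : X' * bool -> W') (kap : W -> bool) (kap' : W' -> bool) (i : X -> X') :
  {in ends E &, forall h z,
     (v' (i h.1, h.2) == v' (i z.1, z.2)) = (v h == v z)} ->
  {in ends E, forall h, kap' (v' (i h.1, h.2)) = kap (v h)} ->
  graph_sum (i @: E) v' kap' = graph_sum E v kap.
Proof.
move=> ker kapE.
(* The translations [f] and [g] between vertices need default values, taken at an edge [x0]; the
   empty graph is treated apart. *)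
have [E0|[x0 x0E]] := set_0Vmem E.
  have e0 (Y : finType) : ends (set0 : {set Y}) = set0 by apply/setP => h; rewrite !inE.
  rewrite /graph_sum E0 !imset0 !e0 !imset0.
  have one (Y Z : finType) (u : Y * bool -> Z) (kp : Z -> bool) : \sum_(chi | colours (set0 : {set Z}) chi)
     (\prod_(w in (set0 : {set Z})) (if kp w then P (chi w) else Q (chi w))) *
     ([forall x in (set0 : {set Y}), (chi (u (x, true)) <= chi (u (x, false)))%N])%:R = 1.
    rewrite (big_pred1 [ffun=> ord0]) => [|chi].
      rewrite big_set0 mul1r (_ : [forall _ in _, _]) //.
      by apply/forall_inP => x; rewrite inE.
    apply/forallP/eqP => [h|-> w]; last by rewrite ffunE eqxx implybT.
    by apply/ffunP => w; have := h w; rewrite inE ffunE => /eqP.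
  by rewrite !one.
pose j h : X' * bool := (i h.1, h.2).
have endsE : ends (i @: E) = j @: ends E.
  apply/setP => -[y b]; rewrite inE; apply/imsetP/imsetP => /= [[x xE ->]|[[x b'] ]].
    by exists (x, b); rewrite ?inE.
  by rewrite inE /= => xE [-> _]; exists x.
pose w0 := v (x0, true).
pose w0' := v' (j (x0, true)).
pose f w' := odflt w0 (omap v [pick h in ends E | v' (j h) == w']).
pose g w := odflt w0' (omap (v' \o j) [pick h in ends E | v h == w]).
have fE h : h \in ends E -> f (v' (j h)) = v h.
  move=> hE; rewrite /f; case: pickP => [z /andP[zE /eqP vz]|/(_ h)]; last by rewrite hE eqxx.
  by apply/eqP; rewrite /= -ker // -/(j z) vz.
have gE h : h \in ends E -> g (v h) = v' (j h).
  move=> hE; rewrite /g; case: pickP => [z /andP[zE /eqP vz]|/(_ h)]; last by rewrite hE eqxx.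
  by apply/eqP; rewrite /= ker // vz.
pose S := v @: ends E; pose S' := v' @: ends (i @: E).
have S'E : S' = (v' \o j) @: ends E by rewrite /S' endsE -imset_comp.
have gS : {in S, forall w, g w \in S' /\ f (g w) = w}.
  move=> _ /imsetP[h hE ->]; rewrite gE // fE // S'E.
  by split=> //; apply: imset_f.
have fS : {in S', forall w, f w \in S /\ g (f w) = w}.
  move=> w; rewrite S'E => /imsetP[h hE ->] /=; rewrite fE // gE //.
  by split=> //; apply: imset_f.
rewrite /graph_sum (sum_recolour _ gS fS); apply: eq_bigr => chi cS; congr (_ * _).
  rewrite -/S -/S' [RHS](reindex_onto f g) => [|w /gS[] //].
  apply: eq_big => [w|w wS'].
    apply/idP/andP => [/fS[-> ->]|[wS /eqP gw]]; first by rewrite eqxx.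
    by rewrite -gw (gS _ wS).1.
  rewrite ffunE wS'; suff -> : kap' w = kap (f w) by [].
  by move: wS'; rewrite S'E => /imsetP[h hE ->]; rewrite fE // /= kapE.
have chiE x b : x \in E -> recolour S' f chi (v' (i x, b)) = chi (v (x, b)).
  move=> xE; have xb : (x, b) \in ends E by rewrite inE.
  by rewrite ffunE -/(j (x, b)) fE // S'E (imset_f (v' \o j) xb).
congr ((nat_of_bool _)%:R); apply/forall_inP/forall_inP => [hx x xE|hx _ /imsetP[x xE ->]].
  by have := hx (i x) (imset_f i xE); rewrite !chiE.
by rewrite -/S' !chiE // hx.
Qed.

Lemma graph_sumU (X W : finType) (E1 E2 : {set X}) (v : X * bool -> W) kap :
  [disjoint v @: ends E1 & v @: ends E2] ->
  graph_sum (E1 :|: E2) v kap = graph_sum E1 v kap * graph_sum E2 v kap.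
Proof.
move=> dis; have -> : graph_sum (E1 :|: E2) v kap =
  \sum_(chi | colours (v @: ends E1 :|: v @: ends E2) chi)
    ((\prod_(w in v @: ends E1) (if kap w then P (chi w) else Q (chi w))) *
     ([forall x in E1, (chi (v (x, true)) <= chi (v (x, false)))%N])%:R) *
    ((\prod_(w in v @: ends E2) (if kap w then P (chi w) else Q (chi w))) *
     ([forall x in E2, (chi (v (x, true)) <= chi (v (x, false)))%N])%:R).
  have eU : ends (E1 :|: E2) = ends E1 :|: ends E2 by apply/setP => h; rewrite !inE.
  rewrite /graph_sum eU imsetU; apply: eq_bigr => chi _.
  rewrite mulrACA -natr_and; congr (_ * (nat_of_bool _)%:R).
    by rewrite -bigU //; apply: eq_bigl => w; rewrite in_setU.
  apply/forall_inP/andP => [h|[/forall_inP h1 /forall_inP h2] x]; last first.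
    by rewrite inE => /orP[/h1|/h2].
  by split; apply/forall_inP => x xE; apply: h; rewrite inE xE ?orbT.
have prodE (S : {set X}) (chi chi' : {ffun W -> K}) : {in v @: ends S, chi =1 chi'} ->
   (\prod_(w in v @: ends S) (if kap w then P (chi w) else Q (chi w))) *
     ([forall x in S, (chi (v (x, true)) <= chi (v (x, false)))%N])%:R =
   (\prod_(w in v @: ends S) (if kap w then P (chi' w) else Q (chi' w))) *
     ([forall x in S, (chi' (v (x, true)) <= chi' (v (x, false)))%N])%:R :> A.
  move=> cc; congr (_ * (nat_of_bool _)%:R); first by apply: eq_bigr => w /cc ->.
  by apply: eq_forallb_in => x xS; rewrite !cc // imset_f // inE.
by rewrite (sum_coloursU dis); [|apply: prodE|apply: prodE].
Qed.
End Colourings.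

Lemma stableE (X : finType) (D : {set X}) (a : {perm X}) x :
  (forall y, y \in D -> a y \in D) -> (a x \in D) = (x \in D).
Proof.
by move=> aD; apply/esym/(porbit_stable aD); rewrite porbit_step porbit_id.
Qed.

Lemma stable_norm (X : finType) (D : {set X}) (a : {perm X}) :
  (forall y, y \in D -> a y \in D) -> a \in 'N(D | 'P)%g.
Proof. by move=> aD; apply/astabsP => x; rewrite /= apermE stableE. Qed.

Lemma cycles_in_eq (X : finType) (D : {set X}) (a b : {perm X}) :
  (forall y, y \in D -> a y \in D) -> {in D, a =1 b} -> cycles_in D a = cycles_in D b.
Proof.
by move=> aD ab; rewrite /cycles_in (@eq_in_imset _ _ _ (porbit b)) // => x; apply: eq_porbit.
Qed.

Lemma porbit_disjoint (X : finType) (D1 D2 : {set X}) (a : {perm X}) :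
  (forall y, y \in D1 -> a y \in D1) -> [disjoint D1 & D2] ->
  [disjoint porbit a @: D1 & porbit a @: D2].
Proof.
move=> aD dis; apply/pred0P => w /=; apply/negP.
move=> /andP[/imsetP[x xD ->] /imsetP[y yD xy]].
have : y \in D1 by apply: (subsetP (sub_porbit aD xD)); rewrite xy porbit_id.
by move/(disjointFr dis); rewrite yD.
Qed.

Lemma cycles_inU (X : finType) (D1 D2 : {set X}) (a : {perm X}) :
  (forall y, y \in D1 -> a y \in D1) -> [disjoint D1 & D2] ->
  cycles_in (D1 :|: D2) a = (cycles_in D1 a + cycles_in D2 a)%N.
Proof.
move=> aD dis; rewrite /cycles_in imsetU cardsU.
by have := porbit_disjoint aD dis; rewrite -setI_eq0 => /eqP ->; rewrite cards0 subn0.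
Qed.

Lemma porbit_emb (X Y : finType) (i : X -> Y) (a : {perm X}) (b : {perm Y}) x y :
  injective i -> (forall z, b (i z) = i (a z)) ->
  (i y \in porbit b (i x)) = (y \in porbit a x).
Proof.
move=> i_inj ba; have it n : (b ^+ n)%g (i x) = i ((a ^+ n)%g x).
  by rewrite !permX; elim: n => //= n ->.
apply/porbitP/porbitP => -[n E]; exists n; first by apply: i_inj; rewrite -it.
by rewrite E it.
Qed.

Section Lift.
Local Open Scope ring_scope.
Variables (X Y : finType) (i : X -> Y).
Hypothesis i_inj : injective i.
Implicit Type t : {perm X}.

Definition lift_fun t y := if [pick x | i x == y] is Some x then i (t x) else y.

Lemma lift_funE t x : lift_fun t (i x) = i (t x).
Proof.
rewrite /lift_fun; case: pickP => [z /eqP/i_inj -> //|/(_ x)]; by rewrite eqxx.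
Qed.

Lemma lift_fun_out t y : y \notin i @: [set: X] -> lift_fun t y = y.
Proof.
rewrite /lift_fun; case: pickP => // x /eqP <-; by rewrite imset_f ?inE.
Qed.

Lemma lift_fun_inj t : injective (lift_fun t).
Proof.
suff K : cancel (lift_fun t) (lift_fun t^-1%g) by apply: can_inj K.
move=> y; have [/imsetP[x _ ->]|yi] := boolP (y \in i @: [set: X]).
  by rewrite !lift_funE permK.
by rewrite !lift_fun_out.
Qed.

Definition lift_perm_along t : {perm Y} := perm (@lift_fun_inj t).

Lemma lift_permE t x : lift_perm_along t (i x) = i (t x).
Proof. by rewrite permE lift_funE. Qed.

Lemma lift_permVE t x : (lift_perm_along t)^-1%g (i x) = i (t^-1%g x).
Proof. by apply: (@perm_inj _ (lift_perm_along t)); rewrite permKV lift_permE permKV. Qed.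

Lemma lift_perm_on t : perm_on (i @: [set: X]) (lift_perm_along t).
Proof.
apply/subsetP => y; rewrite inE; apply: contraR => yi.
by rewrite permE lift_fun_out.
Qed.

Lemma sum_perm_on (A : nmodType) (G : {perm Y} -> A) (C : pred {perm Y}) :
  \sum_(r : {perm Y} | perm_on (i @: [set: X]) r && C r) G r =
  \sum_(t : {perm X} | C (lift_perm_along t)) G (lift_perm_along t).
Proof.
have lift_inj : injective lift_perm_along.
  move=> t t' tt; apply/permP => x; apply: i_inj; by rewrite -!lift_permE tt.
have onE : [set r | perm_on (i @: [set: X]) r] = lift_perm_along @: [set: {perm X}].
  apply/esym/eqP; rewrite eqEcard; apply/andP; split.
    by apply/subsetP => _ /imsetP[t _ ->]; rewrite inE lift_perm_on.
  rewrite card_imset // cardsT cardsE card_perm card_imset // cardsT.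
  rewrite -[X in (_ <= X)%N](eq_card (A := perm_on [set: X])) ?card_perm ?cardsT // => t.
  by rewrite inE; apply/subsetP => y; rewrite inE.
rewrite big_mkcondr /= (eq_bigl (fun r => r \in [set r | perm_on (i @: [set: X]) r])).
  rewrite onE big_imset /=; last by move=> ? ? _ _; apply: lift_inj.
  by rewrite -big_mkcondr /=; apply: eq_bigl => t; rewrite inE.
by move=> r; rewrite inE.
Qed.
End Lift.

(** * Free cumulants as sums over geodesic permutations *)

Section CumulantSums.
Local Open Scope ring_scope.
Variables (A : comNzRingType) (L : nat) (P Q : 'I_L.+1 -> A).

(** The flag keeps apart a white and a black cycle with the same support. *)
Definition vertex (X : finType) (t tb : {perm X}) (h : X * bool) : {set X} * bool :=
  (porbit (if h.2 then t else tb) h.1, h.2).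

Definition map_sum (X : finType) (E : {set X}) (t tb : {perm X}) : A :=
  graph_sum P Q E (vertex t tb) snd.

Lemma map_sum_transfer (X X' : finType) (E : {set X}) (i : X -> X')
    (t tb : {perm X}) (t' tb' : {perm X'}) :
  {in E &, forall x y, (i y \in porbit t' (i x)) = (y \in porbit t x)} ->
  {in E &, forall x y, (i y \in porbit tb' (i x)) = (y \in porbit tb x)} ->
  map_sum (i @: E) t' tb' = map_sum E t tb.
Proof.
move=> tE tbE; apply: graph_sum_transfer => // -[x b] [y b']; rewrite !inE /= => xE yE.
rewrite /vertex !xpair_eqE /=; case: b b' => [] []; rewrite ?andbF // !andbT.
  by rewrite !eq_porbit_mem tE.
by rewrite !eq_porbit_mem tbE.
Qed.

Lemma map_sum_eq (X : finType) (E : {set X}) (t tb t' tb' : {perm X}) :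
  {in E &, forall x y, (y \in porbit t' x) = (y \in porbit t x)} ->
  {in E &, forall x y, (y \in porbit tb' x) = (y \in porbit tb x)} ->
  map_sum E t' tb' = map_sum E t tb.
Proof. by move=> tE tbE; rewrite -{1}[E]imset_id; apply: map_sum_transfer. Qed.

Lemma map_sumU (X : finType) (E1 E2 : {set X}) (t tb : {perm X}) :
  (forall y, y \in E1 -> t y \in E1) -> (forall y, y \in E1 -> tb y \in E1) ->
  [disjoint E1 & E2] -> map_sum (E1 :|: E2) t tb = map_sum E1 t tb * map_sum E2 t tb.
Proof.
move=> tE tbE dis; apply: graph_sumU; apply/pred0P => w /=; apply/negP.
case/andP=> /imsetP[[x b] xE ->] /imsetP[[y b'] yE [xy bb]].
rewrite !inE /= in xE yE; rewrite /= -bb in xy.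
have : y \in E1.
  apply: (subsetP (sub_porbit (s := if b then t else tb) _ xE)); first by case: (b).
  by rewrite xy porbit_id.
by move/(disjointFr dis); rewrite yE.
Qed.

(* [(-1)^(#C(t)+1) N] summed as in [free_cumulant l.+1], but with finitely many
   colours and arbitrary values for the indeterminates. *)
Definition cumulant_sum (l : nat) : A :=
  \sum_(t : 'S_l) \sum_(tb : 'S_l |
      ((tb * t)%g == perm (@ordS_inj l)) &&
      (#|porbits t| + #|porbits tb| == l.+1)%N)
    (-1) ^+ #|porbits t|.+1 * map_sum [set: 'I_l] t tb.

Section Block.
Variables (X : finType) (c : {perm X}).
Implicit Types (D : {set X}) (r : {perm X}).

(** Equality in [cycles_in_mul]. On a single cycle of [c] this is the condition
    [|C(t)| + |C(tb)| = l + 1] of the free cumulants. *)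
Definition geodesic D r :=
  (cycles_in D r + cycles_in D (c * r^-1)%g == #|D| + cycles_in D c)%N.

(** The [+ 1] in the sign of a free cumulant becomes one unit for each cycle of [c], which makes the
    sum multiplicative. *)
Definition block_sum D : A :=
  \sum_(r | perm_on D r && geodesic D r)
    (-1) ^+ (cycles_in D r + cycles_in D c) * map_sum D r (c * r^-1)%g.

Lemma block_sum0 : block_sum set0 = 1.
Proof.
have cyc0 r : cycles_in set0 r = 0%N by rewrite /cycles_in imset0 cards0.
rewrite /block_sum (big_pred1 1%g) => [|r]; last first.
  rewrite /geodesic !cyc0 cards0 eqxx andbT; apply/idP/eqP => [|->]; last exact: perm_on1.
  by move=> r0; apply: (perm_on_id r0); rewrite cards0.
rewrite !cyc0 mul1r /map_sum /graph_sum.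
have -> : ends (set0 : {set X}) = set0 by apply/setP => h; rewrite !inE.
rewrite imset0 (big_pred1 [ffun=> ord0]) => [|chi].
  rewrite big_set0 mul1r (_ : [forall _ in _, _]) //.
  by apply/forall_inP => x; rewrite inE.
apply/forallP/eqP => [h|-> w]; last by rewrite ffunE eqxx implybT.
by apply/ffunP => w; have := h w; rewrite inE ffunE => /eqP.
Qed.

(** A geodesic [r] preserves every cycle of [c], hence splits over [D1] and [D2]. Conversely,
    equality for the union forces it in both parts, since each satisfies the inequality. *)
Lemma block_sumU D1 D2 : [disjoint D1 & D2] ->
  (forall y, y \in D1 -> c y \in D1) -> (forall y, y \in D2 -> c y \in D2) ->
  block_sum (D1 :|: D2) = block_sum D1 * block_sum D2.
Proof.
move=> dis cD1 cD2.
have on1 r1 r2 : perm_on D1 r1 -> perm_on D2 r2 -> {in D1, (r1 * r2)%g =1 r1}.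
  move=> r1D r2D x xD; rewrite permM (out_perm r2D) //.
  by rewrite (disjointFr dis) // perm_closed.
have on2 r1 r2 : perm_on D1 r1 -> perm_on D2 r2 -> {in D2, (r1 * r2)%g =1 r2}.
  by move=> r1D r2D x xD; rewrite permM (out_perm r1D) // (disjointFl dis).
have onU r1 r2 : perm_on D1 r1 -> perm_on D2 r2 -> perm_on (D1 :|: D2) (r1 * r2)%g.
  move=> r1D r2D; apply: perm_onM; [apply: subset_trans r1D _ | apply: subset_trans r2D _].
    exact: subsetUl.
  exact: subsetUr.
have st r D r' : perm_on D r -> {in D, r' =1 r} -> forall y, y \in D -> r' y \in D.
  by move=> rD E y yD; rewrite E // perm_closed.
have inv r D r' : perm_on D r -> {in D, r' =1 r} -> {in D, r'^-1%g =1 r^-1%g}.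
  move=> rD E y yD; have yE : r^-1%g y \in D by rewrite perm_closed ?perm_onV.
  by rewrite -{1}(permKV r y) -(E _ yE) permK.
have cr D r : perm_on D r -> (forall y, y \in D -> c y \in D) ->
    forall y, y \in D -> (c * r^-1)%g y \in D.
  by move=> rD cD y yD; rewrite permM perm_closed ?perm_onV // cD.
have crE D r r' : perm_on D r -> {in D, r' =1 r} -> (forall y, y \in D -> c y \in D) ->
    {in D, (c * r^-1)%g =1 (c * r'^-1)%g}.
  by move=> rD E cD y yD; rewrite !permM (inv _ _ _ rD E) // cD.
have geoE r1 r2 : perm_on D1 r1 -> perm_on D2 r2 ->
    geodesic (D1 :|: D2) (r1 * r2)%g = geodesic D1 r1 && geodesic D2 r2.
  move=> r1D r2D; have E1 := on1 _ _ r1D r2D; have E2 := on2 _ _ r1D r2D.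
  have s1 := st _ _ _ r1D E1.
  rewrite /geodesic !(cycles_inU _ dis) //; last first.
    by move=> y yD; rewrite -(crE _ _ _ r1D E1 cD1) // cr.
  rewrite (cycles_in_eq s1 E1) (cycles_in_eq (st _ _ _ r2D E2) E2).
  rewrite -(cycles_in_eq (cr _ _ r1D cD1) (crE _ _ _ r1D E1 cD1)).
  rewrite -(cycles_in_eq (cr _ _ r2D cD2) (crE _ _ _ r2D E2 cD2)).
  have := cycles_in_mul r1D cD1; have := cycles_in_mul r2D cD2.
  rewrite cardsU; move: (dis); rewrite -setI_eq0 => /eqP ->; rewrite cards0 subn0.
  by move=> le1 le2; apply/eqP/andP => [e|[/eqP e1 /eqP e2]]; [split; apply/eqP|]; lia.
have split_perm r : perm_on (D1 :|: D2) r -> (forall y, y \in D1 -> r y \in D1) ->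
    (forall y, y \in D2 -> r y \in D2) -> (restr_perm D1 r * restr_perm D2 r)%g = r.
  move=> rD r1 r2; have n1 := stable_norm r1; have n2 := stable_norm r2.
  apply/permP => x; rewrite permM; have [x1|x1] := boolP (x \in D1).
    rewrite (restr_permE n1 x1) (out_perm (restr_perm_on D2 r)) //.
    by rewrite (disjointFr dis) // r1.
  rewrite (out_perm (restr_perm_on D1 r)) //; have [x2|x2] := boolP (x \in D2).
    by rewrite restr_permE.
  by rewrite (out_perm (restr_perm_on _ _)) // (out_perm rD) // inE negb_or x1.
have restrE r1 r2 : perm_on D1 r1 -> perm_on D2 r2 ->
    restr_perm D1 (r1 * r2)%g = r1 /\ restr_perm D2 (r1 * r2)%g = r2.
  move=> r1D r2D; have E1 := on1 _ _ r1D r2D; have E2 := on2 _ _ r1D r2D.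
  have n1 := stable_norm (st _ _ _ r1D E1); have n2 := stable_norm (st _ _ _ r2D E2).
  split; apply/permP => x.
    have [xD|xD] := boolP (x \in D1); first by rewrite restr_permE // E1.
    by rewrite (out_perm (restr_perm_on _ _)) // (out_perm r1D).
  have [xD|xD] := boolP (x \in D2); first by rewrite restr_permE // E2.
  by rewrite (out_perm (restr_perm_on _ _)) // (out_perm r2D).
rewrite /block_sum big_distrlr pair_big /=.
rewrite (reindex_onto (fun p : {perm X} * {perm X} => (p.1 * p.2)%g)
   (fun r => (restr_perm D1 r, restr_perm D2 r))) => [|r /andP[rD geo]]; last first.
  have cU y : y \in D1 :|: D2 -> c y \in D1 :|: D2.
    by rewrite !inE => /orP[/cD1 ->|/cD2 ->]; rewrite ?orbT.
  have rc x : r x \in porbit c x by apply: (geodesic_porbit rD cU); apply/eqP.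
  by apply: split_perm => // y yD; [apply: (subsetP (sub_porbit cD1 yD))
    | apply: (subsetP (sub_porbit cD2 yD))].
apply: eq_big => [[r1 r2]|[r1 r2] /andP[_ /eqP[E1 E2]]] /=.
  apply/andP/andP => [[/andP[_ geo] /eqP[E1 E2]]|[/andP[r1D g1] /andP[r2D g2]]].
    have r1D : perm_on D1 r1 by rewrite -E1 restr_perm_on.
    have r2D : perm_on D2 r2 by rewrite -E2 restr_perm_on.
    by move: geo; rewrite geoE // r1D r2D => /andP[-> ->].
  have [-> ->] := restrE _ _ r1D r2D.
  by rewrite onU // geoE // g1 g2 eqxx.
have r1D : perm_on D1 r1 by rewrite -E1 restr_perm_on.
have r2D : perm_on D2 r2 by rewrite -E2 restr_perm_on.
have e1 := on1 _ _ r1D r2D; have e2 := on2 _ _ r1D r2D.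
have s1 := st _ _ _ r1D e1.
rewrite mulrACA -exprD; congr (_ ^+ _ * _).
  rewrite !(cycles_inU _ dis) // (cycles_in_eq s1 e1) (cycles_in_eq (st _ _ _ r2D e2) e2).
  by lia.
rewrite map_sumU //; last by move=> y yD; rewrite -(crE _ _ _ r1D e1 cD1) // cr.
congr (_ * _); apply: map_sum_eq => x y xD yD.
- by rewrite (eq_porbit s1 e1 xD).
- by rewrite (eq_porbit (cr _ _ r1D cD1) (crE _ _ _ r1D e1 cD1) xD).
- by rewrite (eq_porbit (st _ _ _ r2D e2) e2 xD).
- by rewrite (eq_porbit (cr _ _ r2D cD2) (crE _ _ _ r2D e2 cD2) xD).
Qed.

Lemma block_sum_cycle x : block_sum (porbit c x) = cumulant_sum #|porbit c x|.
Proof.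
set l := #|porbit c x|; pose i (j : 'I_l) := iter j c x.
have oE : fingraph.order c x = l by apply: eq_card => y; rewrite porbit_fconnect.
have i_inj : injective i.
  move=> j k /(congr1 (findex c x)); rewrite !findex_iter ?oE // => jk.
  exact: val_inj.
have iT : porbit c x = i @: [set: 'I_l].
  apply/eqP; rewrite eq_sym eqEcard card_imset // cardsT card_ord leqnn andbT.
  by apply/subsetP => _ /imsetP[j _ ->]; rewrite porbit_fconnect fconnect_iter.
pose lc : 'S_l := perm (@ordS_inj l).
have ci j : c (i j) = i (lc j).
  have it : iter l c x = x by rewrite -oE iter_order //; apply: perm_inj.
  rewrite permE -[LHS]/(iter j.+1 c x) /i.
  rewrite -[nat_of_ord (ordS j)]/(j.+1 %% l)%N; have [lt|le] := ltnP j.+1 l.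
    by rewrite modn_small.
  have -> : j.+1 = l by apply/eqP; rewrite eqn_leq le ltn_ord.
  by rewrite modnn it.
have cyc (t : 'S_l) (r : {perm X}) : (forall j, r (i j) = i (t j)) ->
    cycles_in (porbit c x) r = #|porbits t|.
  move=> rt; rewrite porbitsT /cycles_in iT -imset_comp.
  apply: card_imset_eqker => j k _ _ /=.
  by rewrite !eq_porbit_mem (porbit_emb _ _ i_inj rt).
have cycc : cycles_in (porbit c x) c = 1%N.
  rewrite /cycles_in (_ : _ @: _ = [set porbit c x]) ?cards1 //.
  apply/setP => w; rewrite inE; apply/imsetP/eqP => [[y yx ->]|->]; last by exists x; rewrite ?porbit_id.
  by apply/eqP; rewrite eq_porbit_mem.
rewrite /block_sum /cumulant_sum {1}iT sum_perm_on // big_mkcond; apply: eq_bigr => t _.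
set r := lift_perm_along i_inj t.
have rt j : r (i j) = i (t j) by apply: lift_permE.
have crt j : (c * r^-1)%g (i j) = i ((lc * t^-1)%g j) by rewrite !permM ci lift_permVE.
have tbE tb : ((tb * t)%g == lc) = (tb == (lc * t^-1)%g).
  by apply/eqP/eqP => [<-|->]; rewrite ?mulgK ?mulgKV.
rewrite /geodesic (cyc _ _ rt) (cyc _ _ crt) cycc !addn1 -/l.
case: ifP => geo; last first.
  by rewrite big_pred0 // => tb; rewrite tbE; have [->|//] := eqVneq tb (lc * t^-1)%g.
rewrite (big_pred1 (lc * t^-1)%g) => [|tb]; last first.
  by rewrite tbE pred1E; have [->|//] := eqVneq tb (lc * t^-1)%g; rewrite geo.
congr (_ * _); rewrite iT; apply: map_sum_transfer => j k _ _; exact: porbit_emb.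
Qed.

Lemma block_sum_prod D : (forall y, y \in D -> c y \in D) ->
  block_sum D = \prod_(b in porbit c @: D) cumulant_sum #|b|.
Proof.
have [n] := ubnP #|D|; elim: n D => // n IH D lt cD.
have [->|[x xD]] := set_0Vmem D; first by rewrite block_sum0 imset0 big_set0.
pose D1 := porbit c x; pose D2 := D :\: D1.
have sub : D1 \subset D by apply: sub_porbit.
have dis : [disjoint D1 & D2] by rewrite disjoint_sym disjoints_subset subsetDr.
have c1 y : y \in D1 -> c y \in D1 by rewrite porbit_step.
have c2 y : y \in D2 -> c y \in D2.
  by rewrite !inE porbit_step => /andP[-> /cD ->].
have DE : D = D1 :|: D2 by rewrite -{1}(setID D D1) (setIidPr sub).
have lt2 : (#|D2| < n)%N.
  rewrite -ltnS; apply: leq_trans lt; rewrite ltnS; apply: proper_card.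
  by apply/properP; split; [exact: subsetDl | exists x; rewrite // !inE porbit_id].
rewrite DE block_sumU // block_sum_cycle (IH D2 lt2 c2).
have D1E : porbit c @: D1 = [set D1].
  apply/setP => w; rewrite inE; apply/imsetP/eqP => [[y yx ->]|->]; last by exists x; rewrite ?porbit_id.
  by apply/eqP; rewrite eq_porbit_mem.
rewrite imsetU D1E big_setU1 //=.
have := porbit_disjoint c1 dis; rewrite D1E.
by rewrite disjoints1.
Qed.
End Block.
End CumulantSums.

(** * Sums over factorizations *)

Section ReducedSums.
Local Open Scope ring_scope.
Variables (A : nmodType) (X : finType) (F : {set X}).
Implicit Types (r k t : {perm X}).

Lemma sum_reducedl (g : {perm X} -> A) :
  \sum_t g t = \sum_(k | reduced F k) \sum_(r | perm_on F r) g (r * k)%g.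
Proof.
rewrite exchange_big pair_big /=.
pose r0 t := odflt 1%g [pick r | perm_on F r && reduced F (r^-1 * t)%g].
have r0P t : perm_on F (r0 t) && reduced F ((r0 t)^-1 * t)%g.
  rewrite /r0; case: pickP => [r //|no].
  by have [r rF red] := reduced_exists F t; have := no r; rewrite rF red.
rewrite (reindex_onto (fun p : {perm X} * {perm X} => (p.1 * p.2)%g)
  (fun t => (r0 t, ((r0 t)^-1 * t)%g))) => [|t _]; last by rewrite /= mulKVg.
apply: eq_bigl => -[r k] /=; have /andP[rF red] := r0P (r * k)%g.
apply/eqP/andP => [[E1 E2]|[rF' red']]; first by rewrite -{1}E1 -{2}E2.
have E : (r0 (r * k) * ((r0 (r * k))^-1 * (r * k)) = r * k)%g by rewrite mulKVg.
have -> : r0 (r * k)%g = r by apply: (reduced_unique red red' rF rF' E).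
by rewrite mulKg.
Qed.

Lemma sum_reducedr (g : {perm X} -> A) :
  \sum_t g t = \sum_(k | reduced F k) \sum_(r | perm_on F r) g (k * r)%g.
Proof.
rewrite (reindex_inj invg_inj) sum_reducedl (reindex_inj invg_inj) /=.
apply: eq_big => [k|k _]; first exact: reducedV.
rewrite (reindex_inj invg_inj) /=; apply: eq_big => [r|r _].
  by apply/idP/idP => /perm_onV; rewrite ?invgK.
by rewrite invMg !invgK.
Qed.
End ReducedSums.

Section MapSumExpansion.
Local Open Scope ring_scope.
Variables (A : comNzRingType) (L : nat) (P Q : 'I_L.+1 -> A).
Variables (X : finType) (x0 : X).
Implicit Types (t tb k r c sg : {perm X}) (T V F : {set X}).
Local Notation marked := (marked x0).

Lemma map_sum_expansion t tb :
  [transitive <<[set t; tb]>>, on [set: X] | 'P]%g ->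
  map_sum P Q [set: X] t tb =
  \sum_T \sum_(V | marked t tb T V) (-1) ^+ #|V| * map_sum P Q (T :\: V) t tb.
Proof.
move=> /trans_connected conn; set s := vperm t tb.
pose v := vertex t tb; pose S := v @: ends [set: X].
pose wt (chi : {ffun {set X} * bool -> 'I_L.+1}) :=
  \prod_(w in S) (if w.2 then P (chi w) else Q (chi w)).
have vs h : v (s h) = v h.
  rewrite /v /vertex /s vpermE /=; congr (_, _).
  by apply/eqP; rewrite eq_porbit_mem; case: (h.2); rewrite porbit_step porbit_id.
have expand (chi : {ffun {set X} * bool -> 'I_L.+1}) :
    ([forall x in [set: X], (chi (v (x, true)) <= chi (v (x, false)))%N])%:R =
    \sum_T \sum_(V | marked t tb T V) (-1) ^+ #|V| *
      ([forall x in T :\: V, (chi (v (x, true)) <= chi (v (x, false)))%N])%:R :> A.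
  (* Doubling, with 1 added at black ends, excludes ties and turns the weak inequality between
     colours into the strict one of [good_edge]. *)
  pose psi h := ((val (chi (v h))).*2 + ~~ h.2)%N.
  have psi_s h : psi (s h) = psi h by rewrite /psi vs /s vpermE.
  have psi_neq e : psi (e, true) != psi (e, false).
    by rewrite /psi /= addn0 addn1; apply/eqP => /(congr1 odd); rewrite /= !odd_double.
  have goodE e : good_edge psi e = (chi (v (e, true)) <= chi (v (e, false)))%N.
    by rewrite /good_edge /psi /= addn0 addn1 ltnS leq_double.
  have := @tree_expansion X s (x0, true) A psi psi_s psi_neq conn.
  rewrite (_ : [forall e, good_edge psi e] =
    [forall x in [set: X], (chi (v (x, true)) <= chi (v (x, false)))%N]); last first.
    by apply: eq_forallb => e; rewrite inE goodE.
  move=> <-; rewrite big_mkcond; apply: eq_bigr => T _.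
  case: ifP => jT; last by rewrite big_pred0 // => V; rewrite markedE -/s jT.
  apply: eq_big => [V|V _]; first by rewrite markedE -/s jT.
  congr (_ * (nat_of_bool _)%:R); apply: eq_forallb_in => e _; exact: goodE.
rewrite /map_sum /graph_sum -/v -/S.
transitivity (\sum_(chi | colours S chi) \sum_T \sum_(V | marked t tb T V)
   (-1) ^+ #|V| * (wt chi *
      ([forall x in T :\: V, (chi (v (x, true)) <= chi (v (x, false)))%N])%:R)).
  apply: eq_bigr => chi _; rewrite expand big_distrr; apply: eq_bigr => T _.
  by rewrite big_distrr; apply: eq_bigr => V _; rewrite /= mulrCA.
rewrite exchange_big; apply: eq_bigr => T _; rewrite exchange_big; apply: eq_bigr => V mV.
(* By [marked_cover], the forest still meets every vertex, so the colourings and their weights are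
   unchanged. *)
rewrite big_distrr /=; suff -> : v @: ends (T :\: V) = S by [].
apply/eqP; rewrite eqEsubset imsetS ?andTb; last by apply/subsetP => h; rewrite !inE.
apply/subsetP => _ /imsetP[[e b] _ ->].
have /andP[core _] := mV; have [[y b'] + yF] := marked_cover (e, b) core.
rewrite porbit_vperm => /andP[/= /eqP bb ye]; apply/imsetP; exists (y, b').
  by rewrite inE.
by rewrite /v /vertex /= bb; congr (_, _); apply/eqP; rewrite eq_porbit_mem porbit_sym.
Qed.

Definition transitive_sum sg : A :=
  \sum_t \sum_(tb | ((tb * t)%g == sg) &&
      [transitive <<[set t; tb]>>, on [set: X] | 'P]%g)
    (-1) ^+ #|porbits t|.+1 * map_sum P Q [set: X] t tb.

(* The classes: [k1] and [k2] induce the identity on [F], and the members of the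
   class are the [(r * k1, k2 * (c * r^-1))] with [r] a permutation of [F]. *)
Definition core_perm sg k1 k2 := (k2^-1 * sg * k1^-1)%g.

(** The marking is tested on the member with [r = 1]; by [marked_class], the marked members are then
    those with [r] geodesic. *)
Definition skeleton sg T V (p : {perm X} * {perm X}) :=
  let F := T :\: V in let c := core_perm sg p.1 p.2 in
  [&& reduced F p.1, reduced F p.2, perm_on F c & marked p.1 (p.2 * c)%g T V].

(** The tree count of the member with [r = 1] reads [#|T|.+1 = #|F| + cycles_in F c], so [c] has
    [#|V|.+1] cycles on [F]. This turns the sign into that of [block_sum], leaving a product without
    signs. *)
Lemma class_sum sg T V (F := T :\: V) k1 k2 (c := core_perm sg k1 k2) :
  reduced F k1 -> reduced F k2 -> perm_on F c -> marked k1 (k2 * c)%g T V ->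
  \sum_(r | perm_on F r && marked (r * k1)%g (k2 * (c * r^-1))%g T V)
     (-1) ^+ (#|porbits (r * k1)%g|.+1 + #|V|) * map_sum P Q F (r * k1)%g (k2 * (c * r^-1))%g =
  \prod_(b in porbit c @: F) cumulant_sum P Q #|b|.
Proof.
move=> red1 red2 cF mk; rewrite -block_sum_prod; last exact: perm_on_stable.
apply: eq_big => [r|r /andP[rF mr]].
  by have [rF|//] := boolP (perm_on F r); rewrite marked_class // mk.
have crF : perm_on F (c * r^-1)%g by rewrite perm_onM ?perm_onV.
congr (_ * _); last first.
  by apply: map_sum_eq => x y xF yF; rewrite ?(first_return red1 rF) ?(first_returnV red2 crF).
have ker q : perm_on F q -> cycles_in F (q * k1)%g = cycles_in F q.
  move=> qF; apply: card_imset_eqker => x y xF yF.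
  by rewrite !eq_porbit_mem (first_return red1 qF).
have /andP[core' _] := mr; have [-> _] := cover_cycles core'; rewrite -/F ker //.
have /andP[core /eqP cT] := mk; have [E1 E2] := cover_cycles core.
rewrite E1 E2 -/F -[k1]mul1g ker ?perm_on1 // cycles_in_id in cT; last by move=> x _; rewrite perm1.
have ker2 : cycles_in F (k2 * c)%g = cycles_in F c.
  apply: card_imset_eqker => x y xF yF.
  by rewrite !eq_porbit_mem (first_returnV red2 cF).
rewrite ker2 in cT; have sub : V \subset T by case/and4P: core.
have TV : #|T| = (#|V| + #|F|)%N by rewrite -(cardsID V T) (setIidPr sub).
have -> : cycles_in F c = #|V|.+1.
  by apply/eqP; rewrite -(eqn_add2l #|F|) -cT TV addnS addnC.
by rewrite addSnnS.
Qed.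

Lemma transitive_sumE sg : transitive_sum sg =
  \sum_T \sum_V \sum_(p | skeleton sg T V p)
    \prod_(b in porbit (core_perm sg p.1 p.2) @: (T :\: V)) cumulant_sum P Q #|b|.
Proof.
pose G T V t tb := (-1) ^+ (#|porbits t|.+1 + #|V|) * map_sum P Q (T :\: V) t tb.
transitivity (\sum_T \sum_V \sum_t \sum_(tb | ((tb * t)%g == sg) && marked t tb T V) G T V t tb).
  rewrite /transitive_sum.
  transitivity (\sum_t \sum_tb \sum_T \sum_V
     if ((tb * t)%g == sg) && marked t tb T V then G T V t tb else 0).
    apply: eq_bigr => t _; rewrite big_mkcond; apply: eq_bigr => tb _.
    case: ifP => [/andP[/eqP E tr]|/negbT ntr].
      rewrite map_sum_expansion // big_distrr; apply: eq_bigr => T _.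
      rewrite big_distrr big_mkcond E eqxx; apply: eq_bigr => V _ /=.
      by case: ifP => // _; rewrite /G exprD mulrA.
    rewrite big1 // => T _; rewrite big1 // => V _; case: ifP => // /andP[E /marked_trans tr].
    by rewrite E tr in ntr.
  transitivity (\sum_t \sum_T \sum_V \sum_tb
     if ((tb * t)%g == sg) && marked t tb T V then G T V t tb else 0).
    apply: eq_bigr => t _; rewrite exchange_big; apply: eq_bigr => T _.
    by rewrite exchange_big.
  rewrite exchange_big; apply: eq_bigr => T _; rewrite exchange_big; apply: eq_bigr => V _.
  by apply: eq_bigr => t _; rewrite [RHS]big_mkcond.
apply: eq_bigr => T _; apply: eq_bigr => V _; set F := T :\: V.
rewrite (sum_reducedl F) /=.
transitivity (\sum_(k1 | reduced F k1) \sum_(k2 | reduced F k2)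
  if skeleton sg T V (k1, k2) then
    \prod_(b in porbit (core_perm sg k1 k2) @: F) cumulant_sum P Q #|b| else 0); last first.
  rewrite pair_big /= -big_mkcondr; apply: eq_big => [[k1 k2]|[k1 k2] _] //.
  by rewrite /skeleton /=; case: (reduced _ _) => //=; case: (reduced _ _).
apply: eq_bigr => k1 red1.
transitivity (\sum_(r | perm_on F r) \sum_(k2 | reduced F k2) \sum_(r2 | perm_on F r2)
  if ((k2 * r2 * (r * k1))%g == sg) && marked (r * k1)%g (k2 * r2)%g T V
  then G T V (r * k1)%g (k2 * r2)%g else 0).
  by apply: eq_bigr => r rF; rewrite big_mkcond (sum_reducedr F).
rewrite exchange_big; apply: eq_bigr => k2 red2.
set c := core_perm sg k1 k2.
(* Once [k1], [k2] and [r] are chosen, the product [sg] determines the last factor, supported by [F]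
   exactly when [c] is. *)
have cE r r2 : ((k2 * r2 * (r * k1))%g == sg) = (r2 == (c * r^-1)%g).
  rewrite /c /core_perm; apply/eqP/eqP => [<-|->].
    by rewrite -!mulgA mulKg !mulgA mulgK mulgK.
  by rewrite !mulgA mulgKV mulgKV mulgV mul1g.
transitivity (\sum_(r | perm_on F r)
   if perm_on F c && marked (r * k1)%g (k2 * (c * r^-1))%g T V
   then G T V (r * k1)%g (k2 * (c * r^-1))%g else 0).
  apply: eq_bigr => r rF.
  have cFE : perm_on F (c * r^-1)%g = perm_on F c.
    apply/idP/idP => [h|h]; last by rewrite perm_onM ?perm_onV.
    by rewrite -(mulgKV r c) perm_onM.
  rewrite -big_mkcondr -cFE; case: ifP => [/andP[crF mr]|/negbT nmr].
    rewrite (big_pred1 (c * r^-1)%g) // => r2; rewrite cE.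
    by have [->|/negbTE ne] := eqVneq r2 (c * r^-1)%g; rewrite /= ?crF ?mr ?eqxx ?ne ?andbF.
  rewrite big_pred0 // => r2; rewrite cE; have [->|] := eqVneq r2 (c * r^-1)%g; last by rewrite andbF.
  exact: negbTE.
rewrite /skeleton /= red1 red2 -/c -/F /=; have [cF|ncF] := boolP (perm_on F c); last by rewrite big1.
rewrite -big_mkcondr /=; case: ifP => [mk|nmk]; first exact: class_sum.
by rewrite big_pred0 // => r; have [rF|//] := boolP (perm_on F r); rewrite marked_class // nmk.
Qed.
End MapSumExpansion.

(** * Conjugacy *)

Section Conjugacy.
Variable X : finType.
Implicit Types (s t g : {perm X}) (w : {set X}).

Lemma order_porbit s x : fingraph.order s x = #|porbit s x|.
Proof. by apply: eq_card => y; rewrite porbit_fconnect. Qed.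

Lemma orbit_matching s t :
  perm_eq [seq #|pred_of_set w| | w <- enum (porbits s)]
          [seq #|pred_of_set w| | w <- enum (porbits t)] ->
  exists B : {set X} -> {set X},
    {in porbits s &, injective B} /\
    {in porbits s, forall w, B w \in porbits t /\ #|B w| = #|w|}.
Proof.
move=> st; pose sz d s' := [set w in porbits s' | #|pred_of_set w| == d].
have cE d : #|sz d s| = #|sz d t|.
  have szE s' : #|sz d s'| = count_mem d [seq #|pred_of_set w| | w <- enum (porbits s')].
    rewrite count_map cardE -size_filter /sz; apply/perm_size/uniq_perm => [||w].
    - exact: enum_uniq.
    - by rewrite filter_uniq ?enum_uniq.
    - by rewrite mem_enum mem_filter mem_enum inE andbC.
  by rewrite !szE; apply: (seq.permP st).
(* Cycles are matched by their rank among those of the same length. *)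
pose B w := nth set0 (enum (sz #|w| t)) (index w (enum (sz #|w| s))).
have BP : {in porbits s, forall w, B w \in sz #|w| t}.
  move=> w ws; rewrite -mem_enum; apply: mem_nth.
  by rewrite -cardE -cE [X in (_ < X)%N]cardE index_mem mem_enum inE ws eqxx.
have B2 : {in porbits s, forall w, B w \in porbits t /\ #|B w| = #|w|}.
  by move=> w /BP; rewrite inE => /andP[-> /eqP].
exists B; split=> // w w' ws ws' BB.
have ww : #|w| = #|w'| by rewrite -(B2 w ws).2 BB (B2 w' ws').2.
have lt u : u \in porbits s -> (index u (enum (sz #|u| s)) < size (enum (sz #|u| t)))%N.
  by move=> us; rewrite -cardE -cE [X in (_ < X)%N]cardE index_mem mem_enum inE us eqxx.
have := lt _ ws; have := lt _ ws'; move: BB; rewrite /B ww => BB l1 l2.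
have := BB => /eqP; rewrite nth_uniq ?enum_uniq // => /eqP.
have mem u : u \in porbits s -> u \in enum (sz #|u| s) by rewrite mem_enum inE eqxx andbT.
have := mem _ ws; rewrite ww => m1; have m2 := mem _ ws'.
by move=> E; rewrite -(nth_index set0 m1) E nth_index.
Qed.

Lemma perm_eq_conj s t :
  perm_eq [seq #|pred_of_set w| | w <- enum (porbits s)]
          [seq #|pred_of_set w| | w <- enum (porbits t)] ->
  exists g, t = (s ^ g)%g.
Proof.
move=> /orbit_matching[B [Binj BP]].
have os x : porbit s x \in porbits s by apply: imset_f.
pose rep (x : X) w := odflt x [pick y in w].
have repP x w : w != set0 -> rep x w \in w.
  move=> /set0Pn[y yw]; rewrite /rep; case: pickP => // /(_ y).
  by rewrite yw.
have repE x x' w : w != set0 -> rep x w = rep x' w.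
  move=> /set0Pn[y yw]; rewrite /rep; case: pickP => // /(_ y).
  by rewrite yw.
have nz (a : {perm X}) w : w \in porbits a -> w != set0.
  by case/imsetP => x _ ->; apply/set0Pn; exists x; apply: porbit_id.
pose r x := rep x (porbit s x); pose r' x := rep x (B (porbit s x)).
have rx x : r x \in porbit s x by apply/repP/nz/os.
have rE x y : y \in porbit s x -> r y = r x /\ r' y = r' x.
  rewrite -eq_porbit_mem => /eqP yx; rewrite /r /r' yx.
  by split; apply: repE; [apply/nz/os | apply/nz/(BP _ (os x)).1].
have conn x : fconnect s (r x) x by rewrite -porbit_fconnect porbit_sym.
have r'x x : porbit t (r' x) = B (porbit s x).
  have [/imsetP[y _ E] _] := BP _ (os x).
  have : r' x \in B (porbit s x) by apply/repP/nz/(BP _ (os x)).1.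
  by rewrite E -eq_porbit_mem => /eqP.
have ordE x : fingraph.order t (r' x) = fingraph.order s (r x).
  rewrite !order_porbit r'x (BP _ (os x)).2; congr #|pred_of_set _|.
  by apply/esym/eqP; rewrite eq_porbit_mem.
pose i x := findex s (r x) x.
have lti x : (i x < fingraph.order t (r' x))%N by rewrite ordE; apply: findex_max.
(* A point is sent to the one with the same distance from the chosen point of the matched cycle. *)
pose g x := iter (i x) t (r' x).
have g_inj : injective g.
  move=> x y gxy.
  have BB : B (porbit s x) = B (porbit s y).
    rewrite -!r'x; apply/eqP.
    have gP z : porbit t (r' z) = porbit t (g z) by rewrite /g -permX porbit_perm.
    by rewrite !gP gxy.
  have /eqP := Binj _ _ (os x) (os y) BB; rewrite eq_porbit_mem => /rE[rxy r'xy].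
  rewrite -(iter_findex (conn x)) -(iter_findex (conn y)) rxy; congr (iter _ _ _).
  have lty := lti y; rewrite -r'xy in lty.
  have := congr1 (findex t (r' x)) gxy; rewrite /g -r'xy !findex_iter //.
  by rewrite /i rxy.
have gs x : g (s x) = t (g x).
  have [rsx r'sx] : r (s x) = r x /\ r' (s x) = r' x by apply: rE; rewrite porbit_step porbit_id.
  have sxE : s x = iter (i x).+1 s (r x) by rewrite iterS iter_findex.
  have := lti x; rewrite ordE leq_eqVlt => /orP[/eqP ix|ix].
    have sr : s x = r x by rewrite sxE ix iter_order //; apply: perm_inj.
    rewrite /g r'sx {1}/i rsx sr findex0 -[RHS]iterS ix -ordE iter_order //.
    exact: perm_inj.
  by rewrite /g r'sx {1}/i rsx sxE findex_iter.
exists (perm g_inj); apply/permP => y; rewrite -(permKV (perm g_inj) y).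
by rewrite permJ !permE gs.
Qed.
End Conjugacy.

Section TransitiveSumConj.
Variables (A : comNzRingType) (L : nat) (P Q : 'I_L.+1 -> A).
Variables (X : finType).
Implicit Types (t tb sg g : {perm X}).

Let permJE t g x : (t ^ g)%g (g x) = g (t x). Proof. exact: permJ. Qed.

Lemma card_porbitsJ t g : #|porbits (t ^ g)%g| = #|porbits t|.
Proof.
have gT : g @: [set: X] = [set: X].
  by apply/setP => x; rewrite inE; apply/imsetP; exists (g^-1%g x); rewrite ?permKV.
rewrite !porbitsT -{1}gT -imset_comp; apply: card_imset_eqker => x y _ _ /=.
by rewrite !eq_porbit_mem (porbit_emb _ _ (@perm_inj _ g) (permJE t g)).
Qed.

Lemma transitiveJ (G : {set {perm X}}) g :
  [transitive (G :^ g)%g, on [set: X] | 'P] = [transitive G, on [set: X] | 'P].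
Proof.
suff imp (K : {set {perm X}}) h : [transitive K, on [set: X] | 'P] ->
    [transitive (K :^ h)%g, on [set: X] | 'P].
  by apply/idP/idP => [|/imp //]; move/(imp _ g^-1%g); rewrite conjsgK.
case/imsetP => x _ orbx; apply/imsetP; exists (h x); rewrite ?inE //.
apply/setP => y; rewrite inE -(permKV h y); have := orbit_conjsg 'P K h x (h^-1%g y).
by rewrite /= !apermE -orbx inE => ->.
Qed.

(** The expansion depends on a root, so invariance under conjugation is proved for the sum itself;
    one polynomial can then serve all permutations of a type. *)
Lemma transitive_sumJ sg g : transitive_sum P Q (sg ^ g)%g = transitive_sum P Q sg.
Proof.
have gT : g @: [set: X] = [set: X].
  by apply/setP => x; rewrite inE; apply/imsetP; exists (g^-1%g x); rewrite ?permKV.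
rewrite /transitive_sum (reindex_inj (conjg_inj g)) /=; apply: eq_bigr => t _.
rewrite (reindex_inj (conjg_inj g)) /=; apply: eq_big => [tb|tb _].
  rewrite -conjMg (inj_eq (conjg_inj g)); congr (_ && _).
  have -> : [set (t ^ g)%g; (tb ^ g)%g] = ([set t; tb] :^ g)%g by rewrite conjUg !conjg_set1.
  by rewrite genJ transitiveJ.
rewrite card_porbitsJ; congr (_ * _)%R; rewrite -{1}gT.
by apply: map_sum_transfer => x y _ _; apply: porbit_emb => //; apply: perm_inj.
Qed.
End TransitiveSumConj.

(** * Power series *)

Section OrbitColourings.
Local Open Scope ring_scope.
Variables (A : comNzRingType) (L : nat) (P Q : 'I_L.+1 -> A).
Variables (k : nat) (t tb : 'S_k).

Definition orbit_of (s : 'S_k) x : perm_orbit s :=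
  exist _ (porbit s x) (imset_f (porbit s) (isT : x \in predT)).

Lemma orbit_of_surj (s : 'S_k) (w : perm_orbit s) : exists x, w = orbit_of s x.
Proof.
case: w => w ws; have [x _ E] := imsetP ws; exists x; apply: val_inj; exact: E.
Qed.

Lemma map_sum_orbits : map_sum P Q [set: 'I_k] t tb =
  \sum_(phi : {ffun perm_orbit t + perm_orbit tb -> 'I_L.+1} |
      [forall x, (phi (inl (orbit_of t x)) <= phi (inr (orbit_of tb x)))%N])
    (\prod_w P (phi (inl w))) * (\prod_b Q (phi (inr b))).
Proof.
pose v (h : 'I_k * bool) : perm_orbit t + perm_orbit tb :=
  if h.2 then inl (orbit_of t h.1) else inr (orbit_of tb h.1).
pose kap (w : perm_orbit t + perm_orbit tb) := if w is inl _ then true else false.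
rewrite /map_sum -(@graph_sum_transfer _ _ P Q _ _ _ _ [set: 'I_k] (vertex t tb) v snd kap id).
- have vT : v @: ends [set: 'I_k] = [set: perm_orbit t + perm_orbit tb].
    apply/setP => w; rewrite inE; apply/imsetP.
    case: w => w; have [x ->] := orbit_of_surj w.
      by exists (x, true); rewrite ?inE.
    by exists (x, false); rewrite ?inE.
  rewrite imset_id /graph_sum vT [RHS]big_mkcond.
  apply: eq_big => [chi|chi _]; first by apply/forallP => w; rewrite inE.
  have -> : [forall x in [set: 'I_k], (chi (v (x, true)) <= chi (v (x, false)))%N] =
    [forall x, (chi (inl (orbit_of t x)) <= chi (inr (orbit_of tb x)))%N].
    by apply: eq_forallb => x; rewrite inE.
  rewrite (eq_bigl xpredT) => [|w]; last by rewrite inE.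
  by rewrite big_sumType /=; case: ifP => _; rewrite ?mulr1 ?mulr0.
- move=> [x b] [y b'] _ _; rewrite /v /vertex xpair_eqE /=.
  by case: b b' => [] []; rewrite ?andbF ?andbT.
- by move=> [x []].
Qed.
End OrbitColourings.

From mathcomp Require Import finmap boolp classical_sets.
From mathcomp Require Import cardinality fsbigop mpoly reals complex.
From mathcomp Require monalg.
Import Num.Theory.

Section Agreement.
Local Open Scope ring_scope.
Import monalg.
Variable C : comNzRingType.
Local Notation S := (pqseries C).
Local Notation M := ({cmonom (Nstar + Nstar)%type}).
Implicit Types (f g : S) (m n : M).

(* Equality of the coefficients of all divisors of [m]; it only depends on
   finitely many indeterminates and is compatible with the ring operations. *)
Definition agree m f g := forall n, n \in mdivs m -> mvcoef f n = mvcoef g n.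

Lemma agree_eq f g : (forall m, agree m f g) -> f = g.
Proof. by move=> h; apply: mvseriesP => m; apply: h (mdivs_refl m). Qed.

Lemma mvcoef_sum (I : Type) (r : seq I) (D : pred I) (F : I -> S) n :
  mvcoef (\sum_(i <- r | D i) F i) n = \sum_(i <- r | D i) mvcoef (F i) n.
Proof. exact: (big_morph (fun f : S => mvcoef f n)). Qed.

Lemma agree_sum m (I : Type) (r : seq I) (D : pred I) (F G : I -> S) :
  (forall i, D i -> agree m (F i) (G i)) ->
  agree m (\sum_(i <- r | D i) F i) (\sum_(i <- r | D i) G i).
Proof.
move=> FG n nm; rewrite !mvcoef_sum; apply: eq_bigr => i Di; exact: FG.
Qed.

Lemma mdivs_trans m n a : n \in mdivs m -> a \in mdivs n -> a \in mdivs m.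
Proof.
move=> /mdivsP[b nb] /mdivsP[d ad]; apply/mdivsP; exists (monalg.mmul d b).
by rewrite monalg.mulmA ad.
Qed.

Lemma agreeM m f f' g g' : agree m f f' -> agree m g g' -> agree m (f * g) (f' * g').
Proof.
move=> ff gg n nm; have mE (u v : S) := coef_mvmul u v (mdivs_refl n).
rewrite -[LHS]/(mvcoef (mvmul f g) n) -[RHS]/(mvcoef (mvmul f' g') n) !mE.
apply: eq_big_seq => a an; apply: eq_big_seq => b bn.
by rewrite ff ?gg //; apply: (mdivs_trans nm).
Qed.

Lemma agree_prod m (I : Type) (r : seq I) (D : pred I) (F G : I -> S) :
  (forall i, D i -> agree m (F i) (G i)) ->
  agree m (\prod_(i <- r | D i) F i) (\prod_(i <- r | D i) G i).
Proof.
move=> FG; elim/big_ind2: _ => // [f f' g g']; exact: agreeM.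
Qed.

Definition level (x : Nstar + Nstar) : nat := match x with inl i | inr i => val i end.

Section Truncation.
Variable L : nat.
Definition colour_of (j : 'I_L.+1) : Nstar := exist _ j.+1 (ltn0Sn j).
Definition pcolour (j : 'I_L.+1) : S := pvar (colour_of j).
Definition qcolour (j : 'I_L.+1) : S := qvar (colour_of j).
Local Notation P := pcolour.
Local Notation Q := qcolour.

(** A colouring that uses a colour above [L.+1] only contributes monomials containing an
    indeterminate absent from [m], hence from its divisors. *)
Lemma Nseries_agree m k (t tb : 'S_k) :
  (forall x, m x != 0%N -> (level x <= L.+1)%N) ->
  agree m (Nseries C t tb) (map_sum P Q (finset.setTfor 'I_k) t tb).
Proof.
move=> mL n nm; rewrite map_sum_orbits mvcoef_sum.
have nL x : n x != 0%N -> (level x <= L.+1)%N.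
  move=> nx; apply: mL; have /mdivsP[b <-] := nm.
  by rewrite monalg.cmM addn_eq0 negb_and nx.
pose emb (phi : {ffun perm_orbit t + perm_orbit tb -> 'I_L.+1}) : coloring t tb :=
  [ffun x => colour_of (phi x)].
pose adm (phi : {ffun perm_orbit t + perm_orbit tb -> 'I_L.+1}) :=
  [forall x, (phi (inl (orbit_of t x)) <= phi (inr (orbit_of tb x)))%N].
have emb_inj : injective emb.
  move=> phi phi' /ffunP E; apply/ffunP => x; have := E x.
  by rewrite !ffunE => /(congr1 val) [] /val_inj.
have admE phi : admissible (emb phi) <-> adm phi.
  split=> [h|/forallP h w b].
    apply/forallP => x; have := h (orbit_of t x) (orbit_of tb x).
    rewrite !ffunE /= ltnS; apply; apply/finset.set0Pn; exists x.
    by rewrite finset.in_setI !porbit_id.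
  have [x ->] := orbit_of_surj w; have [y ->] := orbit_of_surj b.
  move=> /finset.set0Pn[z]; rewrite finset.in_setI => /= /andP[zx zy].
  have -> : orbit_of t x = orbit_of t z.
    by apply: val_inj => /=; apply/eqP; rewrite eq_sym eq_porbit_mem.
  have -> : orbit_of tb y = orbit_of tb z.
    by apply: val_inj => /=; apply/eqP; rewrite eq_sym eq_porbit_mem.
  by rewrite !ffunE /= ltnS; apply: h.
have termE phi : colterm C (emb phi) =
    (\prod_w P (phi (inl w))) * (\prod_b Q (phi (inr b))).
  apply: (congr2 (fun a b : S => a * b)).
    by apply: eq_bigr => w _; rewrite ffunE.
  by apply: eq_bigr => w _; rewrite ffunE.
have -> : mvcoef (Nseries C t tb) n =
  \sum_(psi \in [set psi | @admissible k t tb psi]%classic) mvcoef (colterm C psi) n by [].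
rewrite (@fsbigE _ _ _ _ _ [seq emb phi | phi <- enum {ffun perm_orbit t + perm_orbit tb -> 'I_L.+1} & adm phi]).
- rewrite big_map big_filter_cond big_enum_cond; apply: eq_big => [phi|phi _].
    rewrite -/(adm phi) inE /=; have [ad|//] := boolP (adm phi).
    by rewrite mem_set //; apply/admE.
  by rewrite termE.
- by rewrite map_inj_uniq // filter_uniq // enum_uniq.
- by move=> _ /mapP[phi + ->]; rewrite mem_filter => /andP[/admE].
- move=> psi /= ad nin; apply/eqP; apply: contraNT nin => nz.
  have nzv (x : perm_orbit t + perm_orbit tb) :
      n (match x with inl _ => inl (psi x) | inr _ => inr (psi x) end) != 0%N.
    apply: (@coef_prod_mvX C _ _ (fun x : perm_orbit t + perm_orbit tb =>
      match x with inl _ => inl (psi x) | inr _ => inr (psi x) end) n).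
    by rewrite big_sumType.
  pose phi : {ffun perm_orbit t + perm_orbit tb -> 'I_L.+1} :=
    [ffun x => inord (val (psi x)).-1].
  have psiE : psi = emb phi.
    apply/ffunP => x; rewrite !ffunE; apply: val_inj => /=.
    have gt0 : (0 < val (psi x))%N := valP (psi x).
    have le : (val (psi x) <= L.+1)%N by have := nL _ (nzv x); case: (x).
    by rewrite inordK ?prednK // -ltnS prednK.
  by rewrite psiE map_f // mem_filter mem_enum andbT; apply/admE; rewrite -psiE.
Qed.
End Truncation.

(** A single [L] must serve all cumulants and all permutations at once; it depends only on the
    indeterminates occurring in [m]. *)
Lemma truncation m : exists L,
  (forall l, agree m (free_cumulant C l.+1) (cumulant_sum (@pcolour L) (@qcolour L) l)) /\
  (forall k (sg : 'S_k), agree m (Sigma' C sg) (transitive_sum (@pcolour L) (@qcolour L) sg)).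
Proof.
exists (\max_(x <- finsupp m) level x)%N; set L := (\max_(x <- _) _)%N.
have mL x : m x != 0%N -> (level x <= L.+1)%N.
  by move=> mx; apply/leqW/leq_bigmax_seq; rewrite // -cmE_neq0.
split=> [l|k sg]; apply: agree_sum => t _; apply: agree_sum => tb _;
  by apply: agreeM => //; apply: Nseries_agree.
Qed.
End Agreement.

(** * The Kerov polynomial *)

Section KerovPolynomial.
Local Open Scope ring_scope.
Variable n : nat.
Implicit Types (sg : 'S_n.+1) (p : 'S_n.+1 * 'S_n.+1).

(** The variable of index [j] stands for [R_(j+2)], and a block of [l] edges contributes [R_(l+1)];
    hence the index [l.-1]. *)
Definition kerov_poly sg : {mpoly int[n.+1]} :=
  \sum_T \sum_V \sum_(p | skeleton ord0 sg T V p)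
    \prod_(b in finset.imset (porbit (core_perm sg p.1 p.2)) (mem (finset.setD T V)))
      'X_(inord #|pred_of_set b|.-1).

Lemma kerov_poly_ge0 sg m : 0 <= (kerov_poly sg)@_m.
Proof.
pose nonneg (q : {mpoly int[n.+1]}) := forall m, 0 <= q@_m.
have n0 : nonneg 0 by move=> u; rewrite mcoeff0.
have nD q q' : nonneg q -> nonneg q' -> nonneg (q + q').
  by move=> hq hq' u; rewrite mcoeffD addr_ge0.
have nM q q' : nonneg q -> nonneg q' -> nonneg (q * q').
  by move=> hq hq' u; rewrite mcoeffM sumr_ge0 // => d _; rewrite mulr_ge0.
suff : nonneg (kerov_poly sg) by apply.
rewrite /kerov_poly; elim/big_ind: _ => // T _; elim/big_ind: _ => // V _.
elim/big_ind: _ => // p _; elim/big_ind: _ => // [|b _] u; last by rewrite mcoeffX ler0n.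
by rewrite mcoeff1 ler0n.
Qed.

Variable C : comNzRingType.
Local Notation S := (pqseries C).

Lemma Sigma'_kerov sg0 sg : cycle_type sg = cycle_type sg0 ->
  Sigma' C sg = mmap intr (fun j : 'I_n.+1 => free_cumulant C j.+2) (kerov_poly sg0).
Proof.
move=> ct; have [g ->] : exists g, sg = (sg0 ^ g)%g.
  apply: perm_eq_conj; rewrite -(perm_sort geq) perm_sym -(perm_sort geq).
  by move: ct; rewrite /cycle_type => <-.
apply: agree_eq => m; have [L [cumE SE]] := truncation C m.
move=> u um; rewrite (SE _ _ u um) transitive_sumJ (transitive_sumE _ _ ord0).
rewrite /kerov_poly rmorph_sum; apply: agree_sum u um => T _.
rewrite rmorph_sum; apply: agree_sum => V _.
rewrite rmorph_sum; apply: agree_sum => p _.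
rewrite rmorph_prod; apply: agree_prod => b bF u um.
have b_gt0 : (0 < #|pred_of_set b|)%N.
  by case/finset.imsetP: bF => x _ ->; rewrite lt0n card_porbit_neq0.
have b_le := max_card (mem b); rewrite card_ord in b_le.
rewrite /= mmapX mmap1U inordK ?prednK //.
by rewrite cumE.
Qed.
End KerovPolynomial.

Local Open Scope ring_scope.

Theorem theorem1p6p1 (R : realType) (k : nat) (mu : seq nat) :
  is_partition k mu ->
  exists2 K : {mpoly int[k]},
    (forall m : 'X_{1..k}, 0 <= K@_m) &
    (forall sigma : 'S_k, cycle_type sigma = mu ->
       Sigma' R[i] sigma =
         mmap intr (fun j : 'I_k => free_cumulant R[i] j.+2) K).
Proof.
case: k => [|n] _.
  (* Transitivity requires an orbit of some point, so for [k = 0] the sum is empty. *)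
  exists 0 => [m|sg _]; first by rewrite mcoeff0.
  rewrite mmap0 /Sigma' big1 // => t _; rewrite big_pred0 // => tb.
  by apply/negbTE/negP => /andP[_ /finset.imsetP[[]]].
(* The polynomial has to be chosen before [sigma], hence from a fixed permutation of the type. *)
have [[sg0 <-]|no] := pselect (exists sg : 'S_n.+1, cycle_type sg = mu).
  by exists (kerov_poly sg0); [exact: kerov_poly_ge0 | move=> sg; apply: Sigma'_kerov].
exists 0 => [m|sg ct]; first by rewrite mcoeff0.
by case: no; exists sg.
Qed.
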